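(* Let $\mathcal X$ be a non-empty finite set, $\mathcal A_x$ non-empty finite sets, $\mathcal Z=\{(x,a):x\in\mathcal X,a\in\mathcal A_x\}$, $P(x,a,\cdot)$ probability measures on $\mathcal X$, $S(x,a,y,\cdot)$ probability measures on $\mathbb R$ with finite second moments, and $\gamma\in[0,1/2)$. Consider Algorithm 2 (described in the context) with parameter $\theta\in(0,1]$ and initial law $\mu_0$ satisfying $\mu_0(x)>0$ for all $x\in\mathcal X$. Then almost surely, $\lim_{k\to\infty}V_{\bar\pi^k}(x)=V^*(x)$ for all $x\in\mathcal X$.
   Context: A (general) policy $\Pi=(\Pi_t)_{t\ge0}$ assigns to each history $h=(x_0,a_0,\dots,x_t)$ a probability $\Pi_t(h,\cdot)$ on $\mathcal A_{x_t}$; an SM policy is a family $\pi(x,\cdot)$ of probabilities on $\mathcal A_x$ used at every time. Given a start $x$ and a policy, $X_0=x$, $A_t$ drawn from the policy given the history, $X_{t+1}\sim P(X_t,A_t,\cdot)$ given the past, and conditionally on the state-action process the rewards $R_{t+1}\sim S(X_t,A_t,X_{t+1},\cdot)$ are independent. $G=\sum_{t\ge0}\gamma^tR_{t+1}$, $V_\Pi(x)=\mathbb E_{x,\Pi}[G]$, $V^*(x)=\sup_\Pi V_\Pi(x)$ over all policies. Algorithm 2 (first-visit Monte-Carlo). Fix $\theta>0$ and a law $\mu_0$ on $\mathcal X$; set $\bar Q^0\equiv0$. For $k\ge0$, given episodes $i=1,\dots,k$, $(X^i_0,A^i_0,X^i_1,R^i_1,A^i_1,\dots)$, and $\bar Q^k$,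 let $\tau^i_{x,a}=\inf\{t\ge0:(X^i_t,A^i_t)=(x,a)\}$ ($\inf\emptyset=\infty$), $N_k(x,a)=\sum_{i=1}^k\mathbf 1_{\{\tau^i_{x,a}<\infty\}}$, $N_k(x)=\sum_{a\in\mathcal A_x}N_k(x,a)$ (empty sums are $0$), $\varepsilon_k(x)=(1+N_k(x))^{-\theta}$ and $$\bar\pi^k(x,a)=\frac{\varepsilon_k(x)}{|\mathcal A_x|}+\mathbf 1_{\{a\in\arg\max\bar Q^k(x,\cdot)\}}\frac{1-\varepsilon_k(x)}{|\arg\max\bar Q^k(x,\cdot)|}.$$ Build episode $k+1$ with $X^{k+1}_0\sim\mu_0$ (independently of the past) and the SM policy $\bar\pi^k$. Then set $\bar Q^{k+1}(x,a)=\frac{\sum_{i=1}^{k+1}\mathbf 1_{\{\tau^i_{x,a}<\infty\}}G^i_{x,a}}{N_{k+1}(x,a)}$ (with $0/0=0$), where $G^i_{x,a}=\sum_{t\ge0}\gamma^tR^i_{\tau^i_{x,a}+t+1}$ ($G^i_{x,a}=0$ if $\tau^i_{x,a}=\infty$). *)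

(* Defs.v *)
From HB Require Import structures.
From mathcomp Require Import all_boot all_order all_algebra.
From mathcomp Require Import all_classical all_reals all_analysis.
Set Implicit Arguments. Unset Strict Implicit. Unset Printing Implicit Defensive.
Import Order.TTheory GRing.Theory Num.Theory.
Import numFieldNormedType.Exports.
Local Open Scope classical_set_scope.
Local Open Scope ring_scope.

(* Finite MDP: states X (finType), a global finite action type Act,    *)
(* admissible actions Aset x ⊆ Act (the sets A_x), transition          *)
(* probabilities Pt x a y = P(x,a,{y}), reward laws S x a y.           *)

(* A general (history-dependent) policy: Pi h x a is the probability of
   action a given history h ++ [x], i.e. h = [(x_0,a_0);...;(x_{t-1},a_{t-1})]
   and current state x_t = x (so t = size h). *)
Definition policy (X Act : finType) (R : realType) := seq (X * Act) -> X -> Act -> R.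

Definition is_policy (R : realType) (X Act : finType) (Aset : X -> {set Act})
  (Pi : policy X Act R) : Prop :=
  forall h x, (forall a, 0 <= Pi h x a) /\ (forall a, a \notin Aset x -> Pi h x a = 0)
              /\ \sum_(a in Aset x) Pi h x a = 1.

Definition sm_policy (R : realType) (X Act : finType) (pi : X -> Act -> R) : policy X Act R :=
  fun _ x a => pi x a.

Definition mean_reward (R : realType) (X Act : finType)
  (S : X -> Act -> X -> probability R R) (x : X) (a : Act) (y : X) : R :=
  fine (\int[S x a y]_r (r%:E))%E.

(* exp_reward ... Pi t h x = E[ R_{|h|+t+1} | history h, current state x ] ;
   in particular exp_reward ... Pi t [::] x = E_{x,Pi}[R_{t+1}]. *)
Fixpoint exp_reward (R : realType) (X Act : finType) (Aset : X -> {set Act})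
  (Pt : X -> Act -> X -> R) (S : X -> Act -> X -> probability R R)
  (Pi : policy X Act R) (t : nat) (h : seq (X * Act)) (x : X) : R :=
  match t with
  | 0 => \sum_(a in Aset x) Pi h x a * \sum_(y : X) Pt x a y * mean_reward S x a y
  | t'.+1 => \sum_(a in Aset x) Pi h x a *
               \sum_(y : X) Pt x a y * exp_reward Aset Pt S Pi t' (rcons h (x, a)) y
  end.

(* V_Pi(x) = E_{x,Pi}[G] = sum_t gamma^t E_{x,Pi}[R_{t+1}] *)
Definition value (R : realType) (X Act : finType) (Aset : X -> {set Act})
  (Pt : X -> Act -> X -> R) (S : X -> Act -> X -> probability R R) (gamma : R)
  (Pi : policy X Act R) (x : X) : R :=
  limn (fun n => \sum_(0 <= t < n) (gamma ^+ t * exp_reward Aset Pt S Pi t [::] x)).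

Definition Vstar (R : realType) (X Act : finType) (Aset : X -> {set Act})
  (Pt : X -> Act -> X -> R) (S : X -> Act -> X -> probability R R) (gamma : R)
  (x : X) : R :=
  sup [set v | exists Pi, is_policy Aset Pi /\ v = value Aset Pt S gamma Pi x].

(* Algorithm 2, as a deterministic function of the sample paths.       *)
(* Episodes are indexed from 0 (episode i here = episode i+1 of the    *)
(* paper). xs i t = X^{i+1}_t, as_ i t = A^{i+1}_t,                    *)
(* rs i t = R^{i+1}_{t+1}.                                             *)
Section Algo.
Context {R : realType} {X Act : finType}.
Variable (Aset : X -> {set Act}).
Variables (xs : nat -> nat -> X) (as_ : nat -> nat -> Act) (rs : nat -> nat -> R).

Definition first_visit (i : nat) (x : X) (a : Act) : option nat :=
  match pselect (exists t, (xs i t == x) && (as_ i t == a)) with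
  | left h => Some (@ex_minn (fun t => (xs i t == x) && (as_ i t == a)) h)
  | right _ => None
  end.

Definition disc_return (gamma : R) (i s : nat) : R :=
  limn (fun n => \sum_(0 <= t < n) (gamma ^+ t * rs i (s + t)%N)).

Definition first_visit_return (gamma : R) (i : nat) (x : X) (a : Act) : R :=
  if first_visit i x a is Some s then disc_return gamma i s else 0.

Definition visits (k : nat) (x : X) (a : Act) : nat :=
  \sum_(i < k) (first_visit i x a != None).

Definition visits_state (k : nat) (x : X) : nat := \sum_(a in Aset x) visits k x a.

(* \bar Q^k (0/0 = 0, as x / 0 = 0 in MathComp) ; \bar Q^0 = 0 *)
Definition Qbar (gamma : R) (k : nat) (x : X) (a : Act) : R :=
  (\sum_(i < k) first_visit_return gamma i x a) / (visits k x a)%:R.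

Definition eps (theta : R) (k : nat) (x : X) : R :=
  (1 + (visits_state k x)%:R) `^ (- theta).

Definition argmaxQ (gamma : R) (k : nat) (x : X) : {set Act} :=
  [set a in Aset x | [forall b in Aset x, Qbar gamma k x b <= Qbar gamma k x a]].

Definition pibar (gamma theta : R) (k : nat) (x : X) (a : Act) : R :=
  if a \in Aset x then
    eps theta k x / #|Aset x|%:R
    + (a \in argmaxQ gamma k x)%:R * (1 - eps theta k x) / #|argmaxQ gamma k x|%:R
  else 0.
End Algo.

Section Law.
Context {R : realType} {X Act : finType} {d : measure_display} {Omega : measurableType d}.
Variable (Aset : X -> {set Act}) (Pt : X -> Act -> X -> R)
         (S : X -> Act -> X -> probability R R).
Variables (Xs : nat -> nat -> Omega -> X) (As : nat -> nat -> Omega -> Act)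
          (Rs : nat -> nat -> Omega -> R).

Definition past_sigma (k : nat) : set (set Omega) :=
  <<s [set E | exists i t, (i < k)%N /\
        ((exists y, E = Xs i t @^-1` [set y]) \/
         (exists b, E = As i t @^-1` [set b]) \/
         (exists U : set R, measurable U /\ E = Rs i t @^-1` U))] >>.

Definition cyl_event (k T : nat) (ys : nat -> X) (bs : nat -> Act) (Us : nat -> set R)
  : set Omega :=
  [set w | (forall t, (t <= T)%N -> Xs k t w = ys t) /\
           (forall t, (t < T)%N -> As k t w = bs t /\ Us t (Rs k t w))].

Definition path_weight (pi : X -> Act -> R) (mu0 : X -> R) (T : nat)
  (ys : nat -> X) (bs : nat -> Act) (Us : nat -> set R) : R :=
  mu0 (ys 0%N) * \prod_(t < T) (pi (ys t) (bs t) * Pt (ys t) (bs t) (ys t.+1)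
                                 * fine (S (ys t) (bs t) (ys t.+1) (Us t))).

Definition pibar_at (gamma theta : R) (w : Omega) (k : nat) : X -> Act -> R :=
  pibar Aset (fun i t => Xs i t w) (fun i t => As i t w) (fun i t => Rs i t w)
        gamma theta k.

(* Episode k is built, conditionally on episodes 0..k-1, with
   X_0 ~ mu0, A_t ~ \bar pi^k(X_t,.), X_{t+1} ~ P(X_t,A_t,.),
   R_{t+1} ~ S(X_t,A_t,X_{t+1},.) conditionally independent. *)
Definition algorithm_law (gamma theta : R) (mu0 : X -> R) (Pr : probability Omega R)
  : Prop :=
  (forall i t y, measurable (Xs i t @^-1` [set y])) /\
  (forall i t b, measurable (As i t @^-1` [set b])) /\
  (forall i t, measurable_fun setT (Rs i t)) /\
  (forall k T ys bs Us B, (forall t, measurable (Us t)) -> past_sigma k B ->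
     Pr (B `&` cyl_event k T ys bs Us)
     = (\int[Pr]_(w in B) (path_weight (pibar_at gamma theta w k) mu0 T ys bs Us)%:E)%E).
End Law.

(* Main.v *)
(* Along almost every path each admissible pair (x, a) is visited infinitely often,
   because in episode k it is tried at time 0 with conditional probability at least
   c / (k + 1). A martingale law of large numbers then shows that the estimate
   Qbar^k(x, a) is asymptotically the average, over the episodes i < k visiting
   (x, a), of the true action values Q_i(x, a) of the policies pibar^i.

   What remains is deterministic. As Q_i <= Q*, the estimates satisfy
   Qbar^k <= Q* + o(1). If moreover Q* - Qbar^k <= delta eventually, an action that
   is greedy for Qbar^k loses at most delta + o(1) with respect to Q*, so
   Q* - Q_k <= gamma delta / (1 - gamma) + o(1), and the averages inherit this
   bound. For gamma < 1/2 the factor gamma / (1 - gamma) is below 1, which drives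
   delta to 0; the one-sided bound is what saves the factor 2 that a naive
   sup-norm estimate would lose. *)
Require Import Defs.
From HB Require Import structures.
From mathcomp Require Import all_boot all_order all_algebra.
From mathcomp Require Import all_classical all_reals all_analysis.
From mathcomp Require Import measurable_realfun ring lra zify.
Set Implicit Arguments. Unset Strict Implicit. Unset Printing Implicit Defensive.
Import Order.TTheory GRing.Theory Num.Theory.
Import numFieldNormedType.Exports.
Local Open Scope classical_set_scope.
Local Open Scope ring_scope.

(** * Values of policies and near-greedy improvement *)

(** The policy of episode [k] depends on all earlier episodes, and the averages run over a random
    number of visits, so sums are indexed by visits rather than by episodes. Given the past, the
    first-visit return minus the true action value on a visit has mean zero and second moment at
    most a constant times the probability of a visit. The variance collected over a range of visit
    counts is thus at most proportional to its length, no matter when these visits occur. No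
    conditional expectation is formed: centred given the past means having zero integral over every
    past event. The law of the algorithm is known on cylinders, and each such integral is reduced to
    cylinders by cutting along the finitely many policies that episode [k] can follow, the time of
    the first visit and the path up to it. The two bounds on [theta] act separately: [theta <= 1]
    keeps the exploration of order at least 1/k, so that its sum diverges, and [theta > 0] makes it
    vanish at states that are visited infinitely often, so that the policies become greedy. *)

Lemma wavg_le (R : realDomainType) (I : finType) (P : pred I) (w f : I -> R) (c : R) :
  (forall i, P i -> 0 <= w i) -> \sum_(i | P i) w i = 1 ->
  (forall i, P i -> f i <= c) -> \sum_(i | P i) w i * f i <= c.
Proof.
move=> w0 w1 fc; rewrite -[leRHS]mul1r -w1 mulr_suml.
by apply: ler_sum => i Pi; rewrite ler_wpM2l ?w0 ?fc.
Qed.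

Lemma norm_wavg_le (R : realDomainType) (I : finType) (P : pred I) (w f : I -> R) (c : R) :
  (forall i, P i -> 0 <= w i) -> \sum_(i | P i) w i = 1 ->
  (forall i, P i -> `|f i| <= c) -> `|\sum_(i | P i) w i * f i| <= c.
Proof.
move=> w0 w1 fc; apply: (le_trans (ler_norm_sum _ _ _)).
under eq_bigr => i Pi do rewrite normrM (ger0_norm (w0 _ Pi)).
exact: wavg_le.
Qed.

Lemma cvg_sumr (R : realType) (I : Type) (r : seq I) (P : pred I)
    (f : I -> nat -> R) (l : I -> R) :
  (forall i, P i -> f i n @[n --> \oo] --> l i) ->
  \sum_(i <- r | P i) f i n @[n --> \oo] --> \sum_(i <- r | P i) l i.
Proof. by apply: cvg_big; exact: add_continuous. Qed.

Lemma filter_fin_forall (T : Type) (F : set_system T) (FF : Filter F) (I : finType)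
    (P : I -> T -> Prop) :
  (forall i, \forall t \near F, P i t) -> \forall t \near F, forall i, P i t.
Proof.
move=> FP; suff : \forall t \near F, forall i, i \in enum I -> P i t.
  by apply: filterS => t H i; apply: H; rewrite mem_enum.
elim: (enum I) => [|i s IH]; first exact: nearW.
apply: filterS2 (FP i) IH => t Pi Ps j; rewrite inE => /orP[/eqP -> //|]; exact: Ps.
Qed.

(** The finitely many indices before the bound sets in add at most the constant [A] to the excess
    over [c], and the growing number of visits makes this smaller than [eta]. Only an upper bound on
    [q] is asked for, so one-sided information passes through averages. *)
Lemma near_avg_le (R : realType) (b : nat -> bool) (q : nat -> R) (c eta : R) :
  (\forall i \near \oo, q i <= c) ->
  (forall M, \forall k \near \oo, (M <= \sum_(i < k) b i)%N) -> 0 < eta ->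
  \forall k \near \oo, (\sum_(i < k) (b i)%:R * q i) / (\sum_(i < k) b i)%:R <= c + eta.
Proof.
move=> [K _ HK] HN eta0; pose A := \sum_(0 <= i < K) `|q i - c|.
have A0 : 0 <= A by exact: sumr_ge0.
have [M HM] : exists M : nat, A / eta < M%:R.
  by exists (Num.bound (A / eta)); rewrite archi_boundP // divr_ge0 // ltW.
have [K' _ HK'] := HN (M.+1); exists (maxn K K') => // k /=.
rewrite geq_max => /andP[Kk /HK' /= Mk].
have N0 : 0 < (\sum_(i < k) b i)%:R :> R by rewrite ltr0n; apply: leq_trans Mk.
rewrite ler_pdivrMr //.
have : \sum_(i < k) (b i)%:R * (q i - c) <= A.
  rewrite -(big_mkord xpredT (fun i => (b i)%:R * (q i - c))) (big_cat_nat (n := K)) //=.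
  rewrite -[leRHS]addr0 lerD //.
    apply: ler_sum => i _; case: (b i); rewrite ?mul1r ?mul0r //; exact: ler_norm.
  rewrite big_nat; apply: sumr_le0 => i /andP[Ki _]; case: (b i); rewrite ?mul0r // mul1r.
  by rewrite subr_le0; exact: HK.
have -> : \sum_(i < k) (b i)%:R * (q i - c) =
    \sum_(i < k) (b i)%:R * q i - c * (\sum_(i < k) b i)%:R.
  by rewrite natr_sum mulr_sumr -sumrB; apply: eq_bigr => i _; rewrite mulrBr [c * _]mulrC.
rewrite lerBlDr => /le_trans; apply; rewrite mulrDl addrC lerD2l //.
move: HM; rewrite ltr_pdivrMr // => /ltW /le_trans; apply.
by rewrite mulrC ler_pM2l // ler_nat ltnW.
Qed.

(** * Bellman equations and comparison principles for discounted values *)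

Section MDP.
Context {R : realType} {X Act : finType}.
Variables (Aset : X -> {set Act}) (Pt : X -> Act -> X -> R).
Variables (S : X -> Act -> X -> probability R R) (gamma : R).

Local Notation ER := (exp_reward Aset Pt S).
Local Notation V := (value Aset Pt S gamma).
Local Notation V_ p := (value Aset Pt S gamma (sm_policy p)).
Local Notation mr := (mean_reward S).
Local Notation Vs := (Vstar Aset Pt S gamma).

Definition lookahead (u : X -> R) (x : X) (a : Act) : R :=
  \sum_(y : X) Pt x a y * (mr x a y + gamma * u y).

Definition stochastic (p : X -> Act -> R) : Prop :=
  forall x, (forall a, 0 <= p x a) /\ (forall a, a \notin Aset x -> p x a = 0)
            /\ \sum_(a in Aset x) p x a = 1.

Definition reward_bound : R := \sum_x \sum_a \sum_y `|mr x a y|.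

(** The history stays an argument because the recursion on the horizon appends the pair just
    played. *)
Definition trunc_value (Pi : policy X Act R) (n : nat) (h : seq (X * Act)) (x : X) : R :=
  \sum_(0 <= t < n) (gamma ^+ t * ER Pi t h x).

Hypothesis Aset_gt0 : forall x, (0 < #|Aset x|)%N.
Hypothesis PtP : forall x a, a \in Aset x ->
  (forall y, 0 <= Pt x a y) /\ \sum_(y : X) Pt x a y = 1.
Hypotheses (gamma_ge0 : 0 <= gamma) (gamma_lt1 : gamma < 1).

Lemma stochastic_policy p : stochastic p -> is_policy Aset (sm_policy p).
Proof. by move=> sp h x; exact: sp. Qed.

Lemma reward_bound_ge x a y : `|mr x a y| <= reward_bound.
Proof.
rewrite /reward_bound (bigD1 x) //= (bigD1 a) //= (bigD1 y) //=.
rewrite -!addrA lerDl !addr_ge0 //; repeat (apply: sumr_ge0 => ? _) => //.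
Qed.

Lemma reward_bound_ge0 : 0 <= reward_bound.
Proof. by do 3 (apply: sumr_ge0 => ? _). Qed.

Lemma exp_reward_bound Pi t h x : is_policy Aset Pi -> `|ER Pi t h x| <= reward_bound.
Proof.
move=> iP; elim: t h x => [|t IH] h x /=;
  have [P0 [_ P1]] := iP h x; apply: norm_wavg_le => // a aA;
  have [Q0 Q1] := PtP aA; apply: norm_wavg_le => // y _.
exact: reward_bound_ge.
Qed.

Lemma trunc_value_cvg Pi h x : is_policy Aset Pi ->
  cvgn (fun n => trunc_value Pi n h x).
Proof.
move=> iP; apply: (@normed_cvg _ _ (fun t => gamma ^+ t * ER Pi t h x : R^o)).
apply: (@series_le_cvg _ _ (geometric reward_bound gamma)) => [n|n|n|].
- exact: normr_ge0.
- by rewrite /= mulr_ge0 ?exprn_ge0 ?reward_bound_ge0.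
- by rewrite /= normrM (ger0_norm (exprn_ge0 _ _)) //= mulrC ler_wpM2r ?exprn_ge0 ?exp_reward_bound.
- by apply: is_cvg_geometric_series; rewrite ger0_norm.
Qed.

Lemma trunc_valueS Pi n h x : trunc_value Pi n.+1 h x =
  \sum_(a in Aset x) Pi h x a *
    \sum_(y : X) Pt x a y * (mr x a y + gamma * trunc_value Pi n (rcons h (x, a)) y).
Proof.
rewrite /trunc_value big_nat_recl //= expr0 mul1r.
under [X in _ + X]eq_bigr => t _ do rewrite mulr_sumr.
rewrite exchange_big /= -big_split /=; apply: eq_bigr => a aA.
under [X in _ + X]eq_bigr => t _ do rewrite mulrCA.
rewrite -mulr_sumr -mulrDr; congr (_ * _).
under [X in _ + X]eq_bigr => t _ do rewrite mulr_sumr.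
rewrite exchange_big /= -big_split /=; apply: eq_bigr => y _.
rewrite mulrDr; congr (_ + _).
by rewrite !mulr_sumr; apply: eq_bigr => t _; rewrite exprS; ring.
Qed.

Lemma exp_reward_sm p t h x : ER (sm_policy p) t h x = ER (sm_policy p) t [::] x.
Proof.
elim: t h x => [//|t IH] h x /=; apply: eq_bigr => a _; congr (_ * _).
by apply: eq_bigr => y _; rewrite IH [in RHS]IH.
Qed.

Lemma trunc_value_sm p n h x :
  trunc_value (sm_policy p) n h x = trunc_value (sm_policy p) n [::] x.
Proof. by apply: eq_bigr => t _; rewrite exp_reward_sm. Qed.

Lemma trunc_value_to p x : stochastic p ->
  trunc_value (sm_policy p) n [::] x @[n --> \oo] --> V_ p x.
Proof. by move=> /stochastic_policy sp; exact: trunc_value_cvg. Qed.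

Lemma value_smE p x : stochastic p ->
  V_ p x = \sum_(a in Aset x) p x a * lookahead (V_ p) x a.
Proof.
move=> sp; have := @trunc_value_to p x sp; rewrite -(cvg_shiftS _) /=.
move=> /cvg_lim <- //; apply/cvg_lim => //.
have -> : (fun n => trunc_value (sm_policy p) n.+1 [::] x) = fun n =>
    \sum_(a in Aset x) p x a *
     \sum_y Pt x a y * (mr x a y + gamma * trunc_value (sm_policy p) n [::] y).
  apply/funext => n; rewrite trunc_valueS; apply: eq_bigr => a _; congr (_ * _).
  by apply: eq_bigr => y _; rewrite trunc_value_sm.
apply: cvg_sumr => a aA; apply: cvgMr; apply: cvg_sumr => y _.
by apply: cvgMr; apply: cvgD; [exact: cvg_cst|apply: cvgMr; exact: trunc_value_to].
Qed.

Lemma lookaheadB u v x a : lookahead u x a - lookahead v x a =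
  gamma * \sum_y Pt x a y * (u y - v y).
Proof.
rewrite /lookahead -sumrB mulr_sumr; apply: eq_bigr => y _; ring.
Qed.

Lemma lookaheadB_le u v c x a : a \in Aset x -> (forall y, u y <= v y + c) ->
  lookahead u x a <= lookahead v x a + gamma * c.
Proof.
move=> /PtP[P0 P1] uv; rewrite addrC -lerBlDr lookaheadB ler_wpM2l //.
by apply: wavg_le => // y _; rewrite lerBlDl.
Qed.

(** Maximum principle: at a state [m] where the difference of [u] and the value of [p] is largest,
    the hypothesis and the Bellman equation give [D <= gamma * D + c] for that maximum [D]. With
    [c = 0] this is policy improvement, with [u = 0] a lower bound on values, and with [u] the
    optimal value it bounds the loss of a nearly greedy policy. *)
Lemma le_value_sm p u c : stochastic p ->
  (forall x, u x <= \sum_(a in Aset x) p x a * lookahead u x a + c) ->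
  forall x, u x <= V_ p x + c / (1 - gamma).
Proof.
move=> sp uc x.
have [m mP] : exists m, forall y, u y - V_ p y <= u m - V_ p m.
  by exists [arg max_(i > x) (u i - V_ p i)]%O; case: arg_maxP => // m _ H y; exact: H.
have [p0 [_ p1]] := sp m.
have : u m - V_ p m <= gamma * (u m - V_ p m) + c.
  rewrite {1}(value_smE _ sp) lerBlDl; apply: (le_trans (uc m)).
  rewrite addrA lerD2r -lerBlDl -sumrB.
  under eq_bigr => a _ do rewrite -mulrBr.
  apply: wavg_le => // a aA; rewrite lerBlDl.
  by apply: lookaheadB_le => // y; rewrite -lerBlDl.
move=> H; rewrite -lerBlDl; apply: (le_trans (mP x)).
rewrite ler_pdivlMr ?subr_gt0 //; lra.
Qed.

Definition det_policy (f : X -> Act) : X -> Act -> R := fun x a => (a == f x)%:R.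

Lemma sum_det_policy f x (g : Act -> R) : f x \in Aset x ->
  \sum_(a in Aset x) det_policy f x a * g a = g (f x).
Proof.
move=> fx; rewrite (bigD1 (f x)) //= /det_policy eqxx mul1r big1 ?addr0 // => a.
by move=> /andP[_ /negbTE ->]; rewrite mul0r.
Qed.

Lemma stochastic_det f : (forall x, f x \in Aset x) -> stochastic (det_policy f).
Proof.
move=> fA x; split; first by move=> a; rewrite ler0n.
split=> [a|]; first by rewrite /det_policy; case: eqP => // ->; rewrite fA.
by have := sum_det_policy (fun=> 1) (fA x); under eq_bigr do rewrite mulr1.
Qed.

(* A deterministic policy maximizing the sum of its values cannot be improved
   at any state, hence solves the Bellman optimality equation. *)
Lemma exists_optimal_det : exists f : X -> Act, (forall x, f x \in Aset x) /\
  (forall x a, a \in Aset x -> lookahead (V_ (det_policy f)) x a <= V_ (det_policy f) x).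
Proof.
have /all_sig [f0 f0A] x : {a | a \in Aset x}.
  by apply/sigW; have /card_gt0P[a aA] := Aset_gt0 x; exists a.
pose P (f : {ffun X -> Act}) := [forall x, f x \in Aset x].
have Pf0 : P [ffun x => f0 x] by apply/forallP => x; rewrite ffunE.
pose F (f : {ffun X -> Act}) := \sum_x V_ (det_policy f) x.
have [f Pf fmax] : exists2 f, P f & forall g, P g -> F g <= F f.
  exists [arg max_(i > [ffun x => f0 x] | P i) F i]%O; by case: arg_maxP.
have fA x : f x \in Aset x by move/forallP: Pf.
exists f; split=> // x0 a0 a0A; rewrite leNgt; apply/negP => lt0.
pose g := [ffun x => if x == x0 then a0 else f x].
have gA x : g x \in Aset x by rewrite ffunE; case: eqP => // ->.
have sf := stochastic_det fA; have sg := stochastic_det gA.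
have Vf x : V_ (det_policy f) x = lookahead (V_ (det_policy f)) x (f x).
  by rewrite {1}value_smE // sum_det_policy.
have Vg x : V_ (det_policy g) x = lookahead (V_ (det_policy g)) x (g x).
  by rewrite {1}value_smE // sum_det_policy.
have le_fg x : V_ (det_policy f) x <= V_ (det_policy g) x.
  have := @le_value_sm _ (V_ (det_policy f)) 0 sg _ x; rewrite mul0r addr0; apply=> y.
  rewrite addr0 sum_det_policy // ffunE; case: eqP => [->|_]; first exact: ltW.
  by rewrite {1}Vf.
have lt_fg : V_ (det_policy f) x0 < V_ (det_policy g) x0.
  apply: (lt_le_trans lt0); rewrite Vg ffunE eqxx -[leRHS]addr0 -(mulr0 gamma).
  by apply: lookaheadB_le => // y; rewrite addr0.
have /fmax : P g by apply/forallP.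
by rewrite leNgt /F (bigD1 x0) //= [ltRHS](bigD1 x0) //= ltr_leD // ler_sum.
Qed.

(** Verification argument for arbitrary history-dependent policies: one step of a supersolution [u],
    reward included, never gains in mean. The last term pays for stopping after [n] steps, where [u]
    may be negative. *)
Lemma trunc_value_le u Pi n h x : is_policy Aset Pi ->
  (forall x a, a \in Aset x -> lookahead u x a <= u x) ->
  trunc_value Pi n h x <= u x + gamma ^+ n * \sum_y `|u y|.
Proof.
move=> iP uB; elim: n h x => [|n IH] h x.
  rewrite /trunc_value big_geq // expr0 mul1r -lerBlDl sub0r (bigD1 x) //=.
  by rewrite (le_trans (ler_norm _)) // normrN lerDl sumr_ge0.
rewrite trunc_valueS; have [P0 [_ P1]] := iP h x.
apply: wavg_le => // a aA; rewrite exprS -mulrA.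
apply: le_trans (lerD (uB _ _ aA) (lexx _)); have [Q0 Q1] := PtP aA.
rewrite -lerBlDl /lookahead -sumrB.
under eq_bigr => y _ do rewrite -mulrBr.
apply: wavg_le => // y _; have := IH (rcons h (x, a)) y.
by move=> /(ler_wpM2l gamma_ge0); lra.
Qed.

Lemma value_le u Pi x : is_policy Aset Pi ->
  (forall x a, a \in Aset x -> lookahead u x a <= u x) -> V Pi x <= u x.
Proof.
move=> iP uB; have c1 := @trunc_value_cvg Pi [::] x iP.
have c2 : u x + gamma ^+ n * \sum_y `|u y| @[n --> \oo] --> u x.
  rewrite -[X in _ --> X]addr0; apply: cvgD; first exact: cvg_cst.
  rewrite -[X in _ --> X](mul0r (\sum_y `|u y|)); apply: cvgMl; apply: cvg_expr.
  by rewrite ger0_norm.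
by apply: (ler_cvg_to c1 c2); apply: nearW => n; exact: trunc_value_le.
Qed.

(** The value of an unimprovable deterministic policy is a supersolution, so it dominates the value
    of every policy; being one of these values itself, it is their supremum. *)
Lemma Vstar_bellman : exists f : X -> Act, (forall x, f x \in Aset x) /\
  (forall x, Vs x = lookahead Vs x (f x)) /\
  (forall x a, a \in Aset x -> lookahead Vs x a <= Vs x).
Proof.
have [f [fA fB]] := exists_optimal_det; exists f.
have sf := stochastic_det fA.
suff -> : Vs = V_ (det_policy f).
  by do 2 split=> //; move=> x; rewrite {1}value_smE // sum_det_policy.
apply/funext => x; rewrite /Vstar; apply/le_anti/andP; split.
  apply: ge_sup => [|_ [Pi [iP ->]]]; last exact: value_le.
  by exists (V_ (det_policy f) x), (sm_policy (det_policy f)); split=> //; exact: stochastic_policy.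
apply: ub_le_sup; last first.
  by exists (sm_policy (det_policy f)); split=> //; exact: stochastic_policy.
by exists (V_ (det_policy f) x) => _ [Pi [iP ->]]; exact: value_le.
Qed.

Lemma value_le_Vstar Pi x : is_policy Aset Pi -> V Pi x <= Vs x.
Proof.
by move=> iP; have [f [fA [_ fB]]] := Vstar_bellman; exact: value_le.
Qed.

Definition value_bound : R := reward_bound / (1 - gamma) + \sum_x `|Vs x|.

Lemma value_sm_bound p x : stochastic p -> `|V_ p x| <= value_bound.
Proof.
move=> sp; have W0 : 0 <= \sum_x `|Vs x| by exact: sumr_ge0.
have M0 : 0 <= reward_bound / (1 - gamma).
  by rewrite divr_ge0 ?reward_bound_ge0 // subr_ge0 ltW.
rewrite ler_norml /value_bound; apply/andP; split.
  have : 0 <= V_ p x + reward_bound / (1 - gamma).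
    apply: (@le_value_sm _ (fun=> 0) _ sp) => y; rewrite -lerBlDr sub0r.
    rewrite lerNl -sumrN; under eq_bigr => a _ do rewrite -mulrN.
    have [p0 [_ p1]] := sp y; apply: wavg_le => // a /PtP[P0 P1].
    rewrite /lookahead -sumrN; under eq_bigr => z _ do rewrite -mulrN mulr0 addr0.
    apply: wavg_le => // z _; apply: le_trans (ler_norm _) _.
    by rewrite normrN reward_bound_ge.
  by lra.
have := value_le_Vstar x (stochastic_policy sp) => /le_trans; apply.
apply: (le_trans (ler_norm _)); rewrite (bigD1 x) //=.
by rewrite addrCA lerDl addr_ge0 // sumr_ge0.
Qed.

Lemma value_bound_ge0 : 0 <= value_bound.
Proof.
by rewrite addr_ge0 ?sumr_ge0 // divr_ge0 ?reward_bound_ge0 // subr_ge0 ltW.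
Qed.

Lemma lookahead_bound p x a : stochastic p -> a \in Aset x ->
  `|lookahead (V_ p) x a| <= reward_bound + gamma * value_bound.
Proof.
move=> sp /PtP[P0 P1]; apply: norm_wavg_le => // y _.
apply: (le_trans (ler_normD _ _)); rewrite lerD ?reward_bound_ge //.
by rewrite normrM (ger0_norm gamma_ge0) ler_wpM2l ?value_sm_bound.
Qed.

Lemma lookahead_le_Vstar p x a : stochastic p -> a \in Aset x ->
  lookahead (V_ p) x a <= lookahead Vs x a.
Proof.
move=> sp aA; rewrite -[leRHS]addr0 -(mulr0 gamma); apply: lookaheadB_le => // y.
by rewrite addr0; apply: value_le_Vstar; exact: stochastic_policy.
Qed.

(** * Deterministic convergence of nearly greedy policies *)

Section Greedy.
Variables (p : nat -> X -> Act -> R) (e : nat -> X -> R) (Q : nat -> X -> Act -> R).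
Variable b : nat -> X -> Act -> bool.
Hypothesis sp : forall k, stochastic (p k).
Hypothesis e0 : forall k x, 0 <= e k x.
Hypothesis e_to0 : forall x, e k x @[k --> \oo] --> 0.
(** Greediness enters in this form: an action whose estimate is beaten gets at most the exploration
    probability, however ties are broken. *)
Hypothesis p_greedy : forall k x a c, a \in Aset x -> c \in Aset x ->
  Q k x a < Q k x c -> p k x a <= e k x.
Hypothesis b_inf : forall x a, a \in Aset x ->
  forall M, \forall k \near \oo, (M <= \sum_(i < k) b i x a)%N.
Hypothesis Q_avg : forall x a, a \in Aset x ->
  Q k x a - (\sum_(i < k) (b i x a)%:R * lookahead (V_ (p i)) x a)
            / (\sum_(i < k) b i x a)%:R @[k --> \oo] --> 0.

Local Notation Qs := (lookahead Vs).

(* The sampled values average the values of actual policies, so they cannot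
   asymptotically exceed the optimal ones. *)
Lemma near_Q_le eta : 0 < eta ->
  \forall k \near \oo, forall xa, xa.2 \in Aset xa.1 -> Q k xa.1 xa.2 <= Qs xa.1 xa.2 + eta.
Proof.
move=> eta0; apply: filter_fin_forall => -[x a] /=.
have [aA|/negP naA] := boolP (a \in Aset x); last exact: nearW.
have e20 : 0 < eta / 2 by rewrite divr_gt0.
have q_le : \forall i \near \oo, lookahead (V_ (p i)) x a <= Qs x a.
  by apply: nearW => i; exact: lookahead_le_Vstar.
have := near_avg_le (b := fun i => b i x a) q_le (b_inf aA) e20.
have /cvgr0Pnorm_le/(_ _ e20) := Q_avg aA.
apply: filterS2 => k /ler_normlW ? ? _; lra.
Qed.

(** The averaging bound applied to negated action values: a bound on the deficit of the sampled
    policies survives averaging at the price of [eta]. *)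
Lemma near_Q_ge c eta : 0 < eta ->
  (\forall k \near \oo, forall xa, xa.2 \in Aset xa.1 ->
     Qs xa.1 xa.2 - lookahead (V_ (p k)) xa.1 xa.2 <= c) ->
  \forall k \near \oo, forall xa, xa.2 \in Aset xa.1 ->
    Qs xa.1 xa.2 - Q k xa.1 xa.2 <= c + eta.
Proof.
move=> eta0 Hc; apply: filter_fin_forall => -[x a] /=.
have [aA|/negP naA] := boolP (a \in Aset x); last exact: nearW.
have e20 : 0 < eta / 2 by rewrite divr_gt0.
have q_le : \forall i \near \oo, - lookahead (V_ (p i)) x a <= c - Qs x a.
  by apply: filterS Hc => i /(_ (x, a) aA) /=; lra.
have := near_avg_le (b := fun i => b i x a) q_le (b_inf aA) e20.
have /cvgr0Pnorm_le/(_ _ e20) := Q_avg aA.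
apply: filterS2 => k /ler_normlP[+ _].
under [X in _ -> X / _ <= _ -> _]eq_bigr do rewrite mulrN.
by rewrite sumrN mulNr => ? ? _; lra.
Qed.

(** An unbeaten action has an estimate at least that of the optimal action [f x]. The latter is
    underestimated by at most [delta] and the former overestimated by at most [eta / 2], so [delta]
    is paid only once. Beaten actions have probability at most [e k x], which tends to 0. The
    comparison principle turns this loss per step into a loss of value. *)
Lemma near_value_ge delta eta : 0 <= delta -> 0 < eta ->
  (\forall k \near \oo, forall xa, xa.2 \in Aset xa.1 ->
    Qs xa.1 xa.2 - Q k xa.1 xa.2 <= delta) ->
  \forall k \near \oo, forall x, Vs x <= V_ (p k) x + (delta + eta) / (1 - gamma).
Proof.
move=> d0 eta0 HQ; have [f [fA [fE fB]]] := Vstar_bellman.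
have e20 : 0 < eta / 2 by rewrite divr_gt0.
pose D x := \sum_(a in Aset x) `|Vs x - Qs x a|.
have eD : \forall k \near \oo, forall x, e k x * D x <= eta / 2.
  apply: filter_fin_forall => x.
  have /cvgr_le : e k x * D x @[k --> \oo] --> 0 by rewrite -(mul0r (D x)); exact: cvgMl.
  exact.
have := near_Q_le e20; move: HQ eD; apply: filterS3 => k HQ eD HU.
apply: le_value_sm => // x; rewrite -lerBlDl; have [p0 [_ p1]] := sp k x.
have -> : Vs x = \sum_(a in Aset x) p k x a * Vs x by rewrite -mulr_suml p1 mul1r.
rewrite -sumrB; under eq_bigr do rewrite -mulrBr.
apply: (@le_trans _ _ (\sum_(a in Aset x)
    (p k x a * (delta + eta / 2) + e k x * `|Vs x - Qs x a|))); last first.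
  rewrite big_split /= -mulr_suml -mulr_sumr p1 mul1r.
  by have := eD x; rewrite /D; lra.
apply: ler_sum => a aA.
have [/existsP[c /andP[cA lt_ac]]|/existsPn unbeaten] :=
    boolP [exists c, (c \in Aset x) && (Q k x a < Q k x c)].
  apply: (@le_trans _ _ (e k x * `|Vs x - Qs x a|)).
    apply: (@le_trans _ _ (p k x a * `|Vs x - Qs x a|)).
      by rewrite ler_wpM2l // ler_norm.
    by rewrite ler_wpM2r // (p_greedy aA cA).
  by rewrite lerDr mulr_ge0 // addr_ge0 // ltW.
rewrite -[leLHS]addr0 lerD ?mulr_ge0 // ler_wpM2l //.
have := unbeaten (f x); rewrite fA /= -leNgt => Qfa.
by have := HQ (x, f x) (fA x); have := HU (x, a) aA; rewrite (fE x) /=; lra.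
Qed.

Lemma greedy_convergence x : gamma < 1 / 2 -> V_ (p k) x @[k --> \oo] --> Vs x.
Proof.
move=> g12; have g1' : 0 < 1 - gamma by rewrite subr_gt0.
pose kap := gamma / (1 - gamma).
have kap0 : 0 <= kap by rewrite divr_ge0 // ltW.
have kap1 : kap < 1 by rewrite ltr_pdivrMr //; lra.
pose E delta := \forall k \near \oo, forall xa, xa.2 \in Aset xa.1 ->
  Qs xa.1 xa.2 - Q k xa.1 xa.2 <= delta.
(* A bound on the deficit of the action values of all policies at once, which starts the iteration;
   the extra 1 in [EC] is the price of averaging. *)
pose C := \sum_x \sum_a `|Qs x a| + (reward_bound + gamma * value_bound).
have C0 : 0 <= C.
  rewrite !addr_ge0 ?reward_bound_ge0 ?mulr_ge0 ?value_bound_ge0 //.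
  by do 2 (apply: sumr_ge0 => ? _).
have EC : E (C + 1).
  apply: near_Q_ge => //; apply: nearW => k -[x' a] /= aA.
  apply: (le_trans (ler_norm _)); apply: (le_trans (ler_normB _ _)).
  rewrite lerD ?lookahead_bound // (bigD1 x') //= (bigD1 a) //= -addrA lerDl.
  by rewrite addr_ge0 // sumr_ge0 // => ? _; rewrite sumr_ge0.
(* Midpoint of [kap] and 1. With the [eta] chosen below, [kap * delta + 2 * eta] equals
   [kap' * delta], so each round contracts by a fixed factor even after paying for averaging and
   exploration. *)
pose kap' := (1 + kap) / 2.
have E_iter delta : 0 < delta -> E delta -> E (kap' * delta).
  move=> d0 Ed; pose eta := (1 - kap) * delta / 4.
  have eta0 : 0 < eta by rewrite divr_gt0 // mulr_gt0 // subr_gt0.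
  have keta : kap * eta <= eta by rewrite ler_piMl // ltW.
  have : E (kap * (delta + eta) + eta).
    apply: near_Q_ge => //.
    apply: filterS (near_value_ge (ltW d0) eta0 Ed) => k HV [x' a] /= aA.
    rewrite lerBlDl; apply: le_trans (lookaheadB_le aA HV) _.
    by rewrite lerD2l /kap mulrA mulrAC.
  apply: filterS => k H xa /H /le_trans; apply.
  have -> : kap' * delta = kap * delta + eta + eta by rewrite /kap' /eta; field.
  by lra.
have kap'0 : 0 < kap' by rewrite divr_gt0 //; lra.
have En n : E (kap' ^+ n * (C + 1)).
  elim: n => [|n IH]; first by rewrite expr0 mul1r.
  rewrite exprS -mulrA; apply: E_iter => //; apply: mulr_gt0; [exact: exprn_gt0|lra].
apply/cvgrPdist_le => ep ep0.
have t0 : 0 < ep * (1 - gamma) / 2 by rewrite divr_gt0 // mulr_gt0.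
have [n Hn] : exists n, kap' ^+ n * (C + 1) <= ep * (1 - gamma) / 2.
  have : kap' ^+ n * (C + 1) @[n --> \oo] --> 0.
    rewrite -(mul0r (C + 1)); apply: cvgMl; apply: cvg_expr.
    by rewrite gtr0_norm // /kap'; lra.
  by move=> /cvgr_le /(_ _ t0) [n _ /(_ n (leqnn n))]; exists n.
have d0 : 0 <= kap' ^+ n * (C + 1) by rewrite mulr_ge0 ?exprn_ge0 ?(ltW kap'0) // addr_ge0.
apply: filterS (near_value_ge d0 t0 (En n)) => k /(_ x) HV.
rewrite ger0_norm; last by rewrite subr_ge0; apply: value_le_Vstar; exact: stochastic_policy.
rewrite lerBlDl; apply: (le_trans HV); rewrite lerD2l ler_pdivrMr //; lra.
Qed.
End Greedy.
End MDP.

(** * A law of large numbers for martingale differences *)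

(** Sigma-algebras are given by generating families, so that comparing two of them comes down to an
    inclusion of generators. *)
Definition adapted (R : realType) d (Omega : measurableType d) (G : set (set Omega))
    (f : Omega -> R) : Prop :=
  measurable_fun [set: g_sigma_algebraType G] (f : g_sigma_algebraType G -> R).

Section SubSigma.
Context {R : realType} {d : measure_display} {Omega : measurableType d}.
Variable Pr : probability Omega R.
Implicit Types (f g D Y : Omega -> R).

Lemma sub_sigma_measurable (G : set (set Omega)) :
  G `<=` measurable -> <<s G >> `<=` measurable.
Proof. by move=> GM; apply: smallest_sub => //; exact: sigma_algebra_measurable. Qed.

Lemma adapted_measurable (G : set (set Omega)) f :
  G `<=` measurable -> adapted G f -> measurable_fun setT f.
Proof.
move=> GM af _ U mU; apply: (sub_sigma_measurable GM); exact: (af measurableT U mU).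
Qed.

Lemma adapted_mono (G H : set (set Omega)) f :
  G `<=` H -> adapted G f -> adapted H f.
Proof.
move=> GH af _ U mU; have := af measurableT U mU.
by apply: sub_sigma_algebra2.
Qed.

Lemma integral_prob_cst (c : R) : (\int[Pr]_w c%:E = c%:E)%E.
Proof.
transitivity (c%:E * Pr setT)%E; last by rewrite probability_setT mule1.
exact: integral_cst.
Qed.

Definition sq_integrable f :=
  measurable_fun setT f /\ (\int[Pr]_w ((f w ^+ 2)%:E) < +oo)%E.

Lemma sq_integrable_sq f : sq_integrable f ->
  Pr.-integrable setT (fun w => (f w ^+ 2)%:E).
Proof.
move=> [mf fi]; apply/integrableP; split.
  by apply/measurable_EFinP; exact: measurable_funX.
by under eq_integral do rewrite gee0_abs ?lee_fin ?sqr_ge0 //.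
Qed.

Lemma sq_integrable_mul f g : sq_integrable f -> sq_integrable g ->
  Pr.-integrable setT (fun w => (f w * g w)%:E).
Proof.
move=> sf sg; apply: (@le_integrable _ _ _ _ _ _ _
  (fun w => (f w ^+ 2)%:E + (g w ^+ 2)%:E)%E) => //.
- apply/measurable_EFinP; apply: measurable_funM; [exact: sf.1|exact: sg.1].
- move=> w _; rewrite -EFinD /= lee_fin (ger0_norm (addr_ge0 (sqr_ge0 _) (sqr_ge0 _))).
  rewrite normrM -(real_normK (num_real (f w))) -(real_normK (num_real (g w))).
  have := sqr_ge0 (`|f w| - `|g w|); have := normr_ge0 (f w); have := normr_ge0 (g w).
  nra.
- by apply: integrableD => //; exact: sq_integrable_sq.
Qed.

Lemma sq_integrable_bounded f (c : R) : measurable_fun setT f ->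
  (forall w, `|f w| <= c) -> sq_integrable f.
Proof.
move=> mf fc; split=> //.
apply: (@le_lt_trans _ _ (\int[Pr]_w ((c ^+ 2)%:E))%E).
  apply: ge0_le_integral => //.
  - by move=> w _; rewrite lee_fin sqr_ge0.
  - by apply/measurable_EFinP; exact: measurable_funX.
  - move=> w _; rewrite lee_fin -real_normK ?num_real //.
    by rewrite lerXn2r ?nnegrE // (le_trans _ (fc w)).
by rewrite integral_prob_cst ltry.
Qed.

Lemma sq_integrable_integrable f : sq_integrable f -> Pr.-integrable setT (EFin \o f).
Proof.
move=> sf; have s1 : sq_integrable (fun=> 1 : R).
  by apply: (@sq_integrable_bounded _ 1) => // w; rewrite normr1.
have := sq_integrable_mul sf s1; apply: eq_integrable => // w _ /=; by rewrite mulr1.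
Qed.

Lemma sq_integrableD f g : sq_integrable f -> sq_integrable g ->
  sq_integrable (fun w => f w + g w).
Proof.
move=> sf sg; split; first by apply: measurable_funD; [exact: sf.1|exact: sg.1].
have -> : (\int[Pr]_w (((f w + g w) ^+ 2)%:E) =
  \int[Pr]_w ((fun w => (f w ^+ 2)%:E + (g w ^+ 2)%:E) \+
             (fun w => (f w * g w)%:E + (f w * g w)%:E)) w)%E.
  apply: eq_integral => w _ /=; rewrite -!EFinD; congr (_%:E); ring.
have I1 := integrableD measurableT (sq_integrable_sq sf) (sq_integrable_sq sg).
have Ifg := sq_integrable_mul sf sg.
have I2 := integrableD measurableT Ifg Ifg.
have /integrableP[_] := integrableD measurableT I1 I2.
apply: le_lt_trans; apply: (le_trans (lee_abs _)).
by apply: le_abse_integral => //; have /integrableP[] := integrableD measurableT I1 I2.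
Qed.

Lemma sq_integrable_indic f (B : set Omega) : measurable B -> sq_integrable f ->
  sq_integrable (fun w => f w * \1_B w).
Proof.
move=> mB [mf fi]; have mg : measurable_fun setT (fun w => f w * \1_B w).
  by apply: measurable_funM => //; exact: measurable_indic.
split=> //; apply: le_lt_trans fi; apply: ge0_le_integral => //.
- by move=> w _; rewrite lee_fin sqr_ge0.
- by apply/measurable_EFinP; exact: measurable_funX.
- by apply/measurable_EFinP; exact: measurable_funX.
- move=> w _; rewrite lee_fin indicE; case: (w \in B); rewrite ?mulr1 // mulr0 expr0n.
  exact: sqr_ge0.
Qed.

(** * Orthogonality of centred variables to the past *)

Section Orthogonal.
Variables (G : set (set Omega)) (D : Omega -> R).
Hypothesis GM : G `<=` measurable.
Hypothesis sD : sq_integrable D.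
Hypothesis D_mean : forall B, <<s G >> B -> (\int[Pr]_(w in B) (D w)%:E = 0)%E.

Import HBNNSimple.

Lemma integral_nnsfun_mul_eq0 (h : {nnsfun g_sigma_algebraType G >-> R}) :
  (\int[Pr]_w ((h w * D w)%:E) = 0)%E.
Proof.
pose B y := h @^-1` [set y].
have GB y : <<s G >> (B y) by exact: (@measurable_sfunP _ _ _ _ h [set y]).
have mB y : d.-measurable (B y : set Omega) by exact: (sub_sigma_measurable GM (GB y)).
have iD := sq_integrable_integrable sD.
transitivity (\int[Pr]_w \sum_(y <- finmap.enum_fset (fset_set (range h))) (y%:E * ((EFin \o D) \_ (B y)) w))%E.
  apply: eq_integral => w _; rewrite [h w]fimfunE fsbig_finite //= mulr_suml -sumEFin.
  apply: eq_bigr => y _; rewrite /B patchE /= indicE -mulrA.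
  by case: (w \in _); [rewrite mul1r EFinM|rewrite mul0r mulr0; exact/esym/mule0].
rewrite integral_sum //; last first.
  move=> y; apply: integrableZl => //; apply/(integrable_mkcond _ (mB y)).
  exact: integrableS iD.
rewrite big1 // => y _; rewrite integralZl //; last first.
  apply/(integrable_mkcond _ (mB y)); exact: integrableS iD.
by rewrite -integral_mkcond D_mean // mule0.
Qed.

Lemma integral_nneg_mul_eq0 Y : adapted G Y -> sq_integrable Y -> (forall w, 0 <= Y w) ->
  (\int[Pr]_w ((Y w * D w)%:E) = 0)%E.
Proof.
move=> aY sY Y0.
have mEY : measurable_fun [set: g_sigma_algebraType G] (fun w : g_sigma_algebraType G => (Y w)%:E).
  exact/measurable_EFinP.
have [h [hnd hY]] := approximation measurableT mEY (fun w _ => Y0 w : 0 <= (Y w)%:E)%E.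
have hY' w : h n w @[n --> \oo] --> Y w by have /fine_cvgP[_] := hY w I.
have hle n w : h n w <= Y w.
  have := hY' w => /cvg_lim <- //.
  apply: (nondecreasing_cvgn_le (u_ := fun n => h n w)); last by apply/cvg_ex; exists (Y w).
  by move=> a b ab; exact/lefP/hnd.
have := @dominated_convergence _ Omega R Pr setT measurableT
  (fun n w => (h n w * D w)%:E) (fun w => (Y w * D w)%:E) (fun w => `|(Y w * D w)%:E|)%E.
case.
- move=> n; apply/measurable_EFinP; apply: measurable_funM; last exact: sD.1.
  by apply: (adapted_measurable GM); exact: measurable_funP.
- by apply/measurable_EFinP; apply: measurable_funM; [exact: sY.1|exact: sD.1].
- apply: aeW => w _; apply/cvg_EFin; first by apply: nearW.
  by apply: cvgMl; exact: hY'.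
- by apply: integrable_abse; exact: sq_integrable_mul.
- apply: aeW => w n _; rewrite !abse_EFin lee_fin !normrM ler_wpM2r //.
  by rewrite !ger0_norm.
move=> _ _; under [X in X @ _]eq_fun => n do rewrite integral_nnsfun_mul_eq0.
by move=> /cvg_lim <- //; rewrite lim_cst.
Qed.

(** Stands in for pulling known factors out of a conditional expectation: zero integral over past
    events extends to past-measurable simple functions, to nonnegative square-integrable variables
    by dominated convergence, and to differences of these. *)
Lemma integral_adapted_mul_eq0 Y : adapted G Y -> sq_integrable Y ->
  (\int[Pr]_w ((Y w * D w)%:E) = 0)%E.
Proof.
move=> aY sY.
pose P w := Num.max (Y w) 0; pose N w := Num.max (- Y w) 0.
have sub Z : adapted G Z -> (forall w, `|Z w| <= `|Y w|) -> sq_integrable Z.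
  move=> aZ ZY; have mZ := adapted_measurable GM aZ; split=> //.
  apply: le_lt_trans sY.2; apply: ge0_le_integral => //.
  - by move=> w _; rewrite lee_fin sqr_ge0.
  - by apply/measurable_EFinP; exact: measurable_funX.
  - by apply/measurable_EFinP; apply: measurable_funX; exact: sY.1.
  - move=> w _; rewrite lee_fin -[leLHS]real_normK ?num_real // -[leRHS]real_normK ?num_real //.
    by rewrite lerXn2r ?nnegrE.
have aP : adapted G P by exact: measurable_maxr.
have aN : adapted G N by apply: measurable_maxr => //; exact: measurable_funN.
have sP : sq_integrable P.
  by apply: sub => // w; rewrite /P; case: (leP (Y w) 0) => _; rewrite ?normr0.
have sN : sq_integrable N.
  by apply: sub => // w; rewrite /N; case: (leP (- Y w) 0) => _; rewrite ?normr0 ?normrN.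
have -> : (\int[Pr]_w ((Y w * D w)%:E) =
   \int[Pr]_w ((fun w => (P w * D w)%:E) \- (fun w => (N w * D w)%:E)) w)%E.
  apply: eq_integral => w _ /=; rewrite -EFinB -mulrBl; congr (_ * _)%:E.
  rewrite /P /N; case: (leP (Y w) 0); case: (leP (- Y w) 0); lra.
rewrite integralB //; [|exact: sq_integrable_mul..].
by rewrite !integral_nneg_mul_eq0 ?sube0 // /P /N => w; rewrite le_max lexx orbT.
Qed.
End Orthogonal.

(** * Law of large numbers in the time scale of visits *)

Section LLN.
Variable F : nat -> set (set Omega).
Hypothesis FM : forall n, F n `<=` measurable.
Hypothesis F_mono : forall n, F n `<=` F n.+1.
Variables (D : nat -> Omega -> R) (v : nat -> Omega -> bool) (C : R).
Hypothesis C0 : 0 <= C.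
Hypothesis D_adapted : forall i, adapted (F i.+1) (D i).
Hypothesis v_meas : forall i, <<s F i.+1 >> [set w | v i w].
Hypothesis D_supp : forall i w, ~~ v i w -> D i w = 0.
Hypothesis D_mean : forall i B, <<s F i >> B -> (\int[Pr]_(w in B) (D i w)%:E = 0)%E.
(** The second moment is charged to the visit itself; this is why second moments of blocks count
    visits and not episodes. *)
Hypothesis D_var : forall i B, <<s F i >> B ->
  (\int[Pr]_(w in B) (D i w ^+ 2)%:E <= C%:E * Pr (B `&` [set w | v i w]))%E.

Definition nvisits (k : nat) (w : Omega) : nat := \sum_(i < k) v i w.

(** Decided before episode [i], so restricting [D i] to it preserves centring: blocks are martingale
    transforms. *)
Definition window (l m i : nat) : set Omega := [set w | (l <= nvisits i w < m)%N].

(* Sum of D over the visits number l, ..., m-1 that occur before episode k *)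
Definition block (l m k : nat) (w : Omega) : R :=
  \sum_(i < k) D i w * \1_(window l m i) w.

Lemma nvisits_meas k n : <<s F k >> [set w | nvisits k w = n].
Proof.
elim: k n => [|k IH] n.
  case: n => [|n]; [rewrite (_ : [set _ | _] = setT)|rewrite (_ : [set _ | _] = set0)].
  - exact: (@measurableT _ (g_sigma_algebraType (F 0))).
  - by apply/seteqP; split=> w //= _; rewrite /nvisits big_ord0.
  - exact: (@measurable0 _ (g_sigma_algebraType (F 0))).
  - by apply/seteqP; split=> w //=; rewrite /nvisits big_ord0.
have up m : <<s F k.+1 >> [set w | nvisits k w = m].
  by have := IH m; apply: sub_sigma_algebra2; exact: F_mono.
have -> : [set w | nvisits k.+1 w = n] =
   ([set w | nvisits k w = n] `\` [set w | v k w]) `|`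
   (if n is n'.+1 then [set w | nvisits k w = n'] `&` [set w | v k w] else set0).
  apply/seteqP; split=> w /=; rewrite /nvisits big_ord_recr /=.
    case vk: (v k w) => /=; last by rewrite addn0; left.
    by rewrite addn1 => sn; right; rewrite -sn; split.
  case=> [[-> /negP/negbTE ->]|]; first by rewrite addn0.
  by case: n => // n [-> ->]; rewrite addn1.
apply: (@measurableU _ (g_sigma_algebraType (F k.+1))).
  by apply: (@measurableD _ (g_sigma_algebraType (F k.+1))); [exact: up|exact: v_meas].
case: n => [|n]; first exact: (@measurable0 _ (g_sigma_algebraType (F k.+1))).
by apply: (@measurableI _ (g_sigma_algebraType (F k.+1))); [exact: up|exact: v_meas].
Qed.

Lemma window_meas l m k : <<s F k >> (window l m k).
Proof.
have -> : window l m k = \bigcup_(n in [set n | (l <= n < m)%N]) [set w | nvisits k w = n].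
  apply/seteqP; split=> w /= => [H|[n H nE]]; last by rewrite /window /= nE.
  by exists (nvisits k w).
apply: (@bigcup_measurable _ (g_sigma_algebraType (F k))) => n _; exact: nvisits_meas.
Qed.

Lemma window_measurable l m k : measurable (window l m k).
Proof. by apply: (sub_sigma_measurable (@FM k)); exact: window_meas. Qed.

Lemma visit_measurable k : measurable [set w | v k w].
Proof. by apply: (sub_sigma_measurable (@FM k.+1)); exact: v_meas. Qed.

Lemma D_sq i : sq_integrable (D i).
Proof.
split; first by apply: (@adapted_measurable (F i.+1)); [exact: FM|exact: D_adapted].
have mT : <<s F i >> setT by exact: (@measurableT _ (g_sigma_algebraType (F i))).
apply: (le_lt_trans (D_var mT)); rewrite setTI.
apply: (@le_lt_trans _ _ (C%:E * 1)%E); last by rewrite mule1 ltry.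
apply: lee_wpmul2l; rewrite ?lee_fin //; apply: probability_le1; exact: visit_measurable.
Qed.

Lemma block_sq l m k : sq_integrable (block l m k).
Proof.
rewrite /block; elim: k => [|k IH].
  apply: (@sq_integrable_bounded _ 0) => [|w]; last by rewrite big_ord0 normr0.
  by under eq_fun do rewrite big_ord0; exact: measurable_cst.
under eq_fun do rewrite big_ord_recr /=.
apply: sq_integrableD => //; apply: sq_integrable_indic; last exact: D_sq.
exact: window_measurable.
Qed.

Lemma block_adapted l m k : adapted (F k) (block l m k).
Proof.
rewrite /block; elim: k => [|k IH].
  by rewrite /adapted; under eq_fun do rewrite big_ord0; exact: measurable_cst.
rewrite /adapted; under eq_fun do rewrite big_ord_recr /=.
apply: measurable_funD; first by have := IH; apply: adapted_mono; exact: F_mono.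
apply: measurable_funM; first exact: D_adapted.
apply: (@measurable_indic _ (g_sigma_algebraType (F k.+1))).
by have := @window_meas l m k; apply: sub_sigma_algebra2; exact: F_mono.
Qed.

(** When the square of one more increment is expanded, the cross term vanishes because both the
    earlier block and the window are known before episode [k]; the new square is bounded by the
    variance hypothesis on the window. *)
Lemma integral_block_sq_le l m k : (\int[Pr]_w ((block l m k w ^+ 2)%:E) <=
  C%:E * \sum_(i < k) Pr (window l m i `&` [set w | v i w]))%E.
Proof.
elim: k => [|k IH].
  rewrite big_ord0 mule0 (eq_integral (cst 0%E)) ?integral0 //.
  by move=> w _; rewrite /block big_ord0 expr0n.
have mW := window_measurable l m k.
pose Y w := block l m k w * \1_(window l m k) w.
have sY : sq_integrable Y by apply: sq_integrable_indic => //; exact: block_sq.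
have aY : adapted (F k) Y.
  apply: measurable_funM; first exact: block_adapted.
  by apply: (@measurable_indic _ (g_sigma_algebraType (F k))); exact: window_meas.
have YD0 := integral_adapted_mul_eq0 (@FM k) (D_sq k) (@D_mean k) aY sY.
pose dk w := D k w * \1_(window l m k) w.
have sdk : sq_integrable dk by apply: sq_integrable_indic => //; exact: D_sq.
have iYD := sq_integrable_mul sY (D_sq k).
have -> : (\int[Pr]_w ((block l m k.+1 w ^+ 2)%:E) = \int[Pr]_w
   ((fun w => (block l m k w ^+ 2)%:E + (dk w ^+ 2)%:E) \+
     (fun w => 2%:E * (Y w * D k w)%:E)) w)%E.
  apply: eq_integral => w _ /=; rewrite -EFinM -!EFinD; congr (_%:E).
  by rewrite /block big_ord_recr /= -/(block l m k w) /dk /Y; ring.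
rewrite integralD //; last 2 first.
- by apply: integrableD => //; apply: sq_integrable_sq => //; exact: block_sq.
- exact: integrableZl.
rewrite integralZl // YD0 mule0 adde0 integralD //; last 2 first.
- by apply: sq_integrable_sq; exact: block_sq.
- exact: sq_integrable_sq.
rewrite big_ord_recr /= ge0_muleDr ?sume_ge0 //.
apply: leeD => //; apply: le_trans (D_var (@window_meas l m k)).
rewrite [leRHS]integral_mkcond; rewrite le_eqVlt; apply/orP; left; apply/eqP; apply: eq_integral => w _.
rewrite patchE /dk indicE; case: (w \in _); rewrite ?mulr1 // mulr0 expr0n //.
Qed.

Lemma sum_window_le l m k w : (l <= m)%N ->
  (\sum_(i < k) (v i w && (l <= nvisits i w < m)) <= m - l)%N.
Proof.
move=> lm.
(* The sharper bound records how far the counter has advanced through the range, which the induction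
   needs. *)
suff : (\sum_(i < k) (v i w && (l <= nvisits i w < m)) <= minn (nvisits k w) m - l)%N.
  by move=> /leq_trans; apply; rewrite leq_sub2r // geq_minr.
elim: k => [|k IH]; first by rewrite big_ord0.
rewrite big_ord_recr /= [X in minn X _]/nvisits big_ord_recr /= -/(nvisits k w).
move: IH; set s := (\sum_(i < k) _)%N; move: s (nvisits k w) => s n IH.
case: (v k w); rewrite /= ?addn0 //.
case: (leqP l n) => ln /=; last by rewrite addn0; apply: (leq_trans IH); lia.
case: (ltnP n m) => nm; lia.
Qed.

(** The sum is the expected number of visits made while the counter lies in the window, and each
    path has at most [m - l] of them. *)
Lemma sum_Pr_window_le l m k : (l <= m)%N ->
  (\sum_(i < k) Pr (window l m i `&` [set w | v i w]) <= (m - l)%:R%:E)%E.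
Proof.
move=> lm; have mW i : measurable (window l m i `&` [set w | v i w]).
  by apply: measurableI; [exact: window_measurable|exact: visit_measurable].
have -> : (\sum_(i < k) Pr (window l m i `&` [set w | v i w]) =
  \int[Pr]_w \sum_(i < k) (\1_(window l m i `&` [set w | v i w]) w)%:E)%E.
  rewrite ge0_integral_sum // => [|i]; last first.
    by apply/measurable_EFinP; exact: measurable_indic.
  by apply: eq_bigr => i _; rewrite integral_indic // setIT.
rewrite -[leRHS]integral_prob_cst.
apply: ge0_le_integral => //.
- by move=> w _; apply: sume_ge0.
- by apply: emeasurable_sum => i; apply/measurable_EFinP; exact: measurable_indic.
- move=> w _; rewrite sumEFin lee_fin /=.
  apply: le_trans (_ : (\sum_(i < k) (v i w && (l <= nvisits i w < m)))%N%:R <= _).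
    rewrite natr_sum; apply: ler_sum => i _; rewrite indicE.
    case: (boolP (w \in _)) => //; rewrite inE /window /= => -[-> ->] //.
  by rewrite ler_nat; exact: sum_window_le.
Qed.

(** The squared block once it is complete. A lower limit makes sense on every path, also where the
    count never reaches [m], and Fatou's lemma carries the second-moment bound over to it. *)
Definition limit_block (l m : nat) (w : Omega) : \bar R :=
  limn_einf (fun k => ((block l m k w ^+ 2)%:E)).

Lemma block_sq_measurable l m k : measurable_fun setT (fun w => (block l m k w ^+ 2)%:E).
Proof.
by apply/measurable_EFinP; apply: measurable_funX; have [] := block_sq l m k.
Qed.

Lemma limit_block_measurable l m : measurable_fun setT (limit_block l m).
Proof.
rewrite /limit_block (_ : (fun w => _) =
  (fun w => - limn_esup (fun k => - (block l m k w ^+ 2)%:E))%E); last first.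
  by apply/funext => w; rewrite -limn_einfN; f_equal; apply/funext => k; rewrite /comp oppeK.
apply: measurableT_comp => //; apply: measurable_fun_limn_esup => k.
by apply: measurableT_comp => //; exact: block_sq_measurable.
Qed.

Lemma limit_block_ge0 l m w : (0 <= limit_block l m w)%E.
Proof.
rewrite /limit_block limn_einf_lim; apply: lime_ge; first exact: is_cvg_einfs.
apply: nearW => n; apply: le_ereal_inf_tmp => _ [k _ <-] /=.
by rewrite lee_fin sqr_ge0.
Qed.

Lemma integral_limit_block_le l m : (l <= m)%N ->
  (\int[Pr]_w limit_block l m w <= (C * (m - l)%:R)%:E)%E.
Proof.
move=> lm; have le_k k : (\int[Pr]_w (block l m k w ^+ 2)%:E <= (C * (m - l)%:R)%:E)%E.
  apply: (le_trans (integral_block_sq_le l m k)); rewrite EFinM.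
  by apply: lee_wpmul2l; rewrite ?lee_fin //; exact: sum_Pr_window_le.
apply: (le_trans (fatou _ _ _ _)) => //.
- by move=> n; exact: block_sq_measurable.
- by move=> n w _; rewrite lee_fin sqr_ge0.
rewrite limn_einf_lim; apply: lime_le; first exact: is_cvg_einfs.
apply: nearW => n; apply: le_trans (le_k n).
by apply: ereal_inf_lbound; exists n => /=.
Qed.

Lemma nvisits_le i k w : (i <= k)%N -> (nvisits i w <= nvisits k w)%N.
Proof.
move=> /subnKC <-; elim: (k - i)%N => [|n IH]; first by rewrite addn0.
by rewrite addnS {2}/nvisits big_ord_recr /= -/(nvisits (i + n) w) (leq_trans IH) // leq_addr.
Qed.

Lemma block_stable l m k K w : (m <= nvisits k w)%N -> (k <= K)%N ->
  block l m K w = block l m k w.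
Proof.
move=> mk /subnKC <-; elim: (K - k)%N => [|n IH]; first by rewrite addn0.
rewrite addnS /block big_ord_recr /= -/(block l m (k + n) w) IH indicE memNset ?mulr0 ?addr0 //.
rewrite /window /= ltnNge => /andP[_ /negP]; apply; apply: leq_trans mk _.
by apply: nvisits_le; exact: leq_addr.
Qed.

Lemma limit_blockE l m k w : (m <= nvisits k w)%N ->
  limit_block l m w = (block l m k w ^+ 2)%:E.
Proof.
move=> mk.
have : (block l m K w ^+ 2)%:E @[K --> \oo] --> (block l m k w ^+ 2)%:E.
  by apply: cvg_near_cst; exists k => // K /= kK; rewrite (block_stable l mk kK).
by move=> /cvg_limn_einf_sup[+ _].
Qed.

Lemma block_total k w : block 0 (nvisits k w) k w = \sum_(i < k) D i w.
Proof.
apply: eq_bigr => i _; have [vi|/D_supp->] := boolP (v i w); last by rewrite mul0r.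
rewrite indicE mem_set ?mulr1 // /window /=.
apply: leq_trans (nvisits_le w (ltn_ord i)).
by rewrite /nvisits big_ord_recr /= vi addn1.
Qed.

Lemma block_split l m n k w : (l <= m <= n)%N ->
  block l n k w = block l m k w + block m n k w.
Proof.
move=> /andP[lm mn]; rewrite -big_split /=; apply: eq_bigr => i _.
rewrite -mulrDr !indicE; congr (_ * _); rewrite -natrD; congr _%:R.
have E a b : (w \in window a b i) = (a <= nvisits i w < b)%N.
  by apply/idP/idP; rewrite inE.
rewrite !E; lia.
Qed.

(* Rajchman's argument: second-moment bounds at the visit counts r^2, with r = n + 1,
   and for the increments up to (r + 1)^2 replace a maximal inequality. *)
Definition scaled_block (n : nat) (w : Omega) : \bar R :=
  ((n.+1%:R ^- 4)%:E * (limit_block 0 (n.+1 ^ 2) w +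
     \sum_(j < 2 * n + 4) limit_block (n.+1 ^ 2) (n.+1 ^ 2 + j) w))%E.

Lemma scaled_block_ge0 n w : (0 <= scaled_block n w)%E.
Proof.
apply: mule_ge0; first by rewrite lee_fin invr_ge0 exprn_ge0.
by apply: adde_ge0; [|apply: sume_ge0 => *]; exact: limit_block_ge0.
Qed.

Lemma scaled_block_measurable n : measurable_fun setT (scaled_block n).
Proof.
apply: measurable_funeM; apply: emeasurable_funD; first exact: limit_block_measurable.
by apply: emeasurable_sum => j; exact: limit_block_measurable.
Qed.

(** With [N = n + 1], the second moments add up to at most [C] times [N ^ 2 + (2 * n + 4) * 4 * N <=
    17 * N ^ 2]. Division by [N ^ 4] leaves [17 / N ^ 2 <= 34 / (N * (N + 1))], a telescoping
    term. *)
Lemma integral_scaled_block_le n :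
  (\int[Pr]_w scaled_block n w <= (34 * C * (n.+1%:R^-1 - n.+2%:R^-1))%:E)%E.
Proof.
have n0 : 0 < n.+1%:R :> R by rewrite ltr0n.
rewrite ge0_integralZl //; last 2 first.
- apply: emeasurable_funD; first exact: limit_block_measurable.
  by apply: emeasurable_sum => j; exact: limit_block_measurable.
- by move=> w _; apply: adde_ge0; [|apply: sume_ge0 => *]; exact: limit_block_ge0.
rewrite ge0_integralD //; last 4 first.
- by move=> w _; exact: limit_block_ge0.
- exact: limit_block_measurable.
- by move=> w _; apply: sume_ge0 => *; exact: limit_block_ge0.
- by apply: emeasurable_sum => j; exact: limit_block_measurable.
rewrite ge0_integral_sum //; last 2 first.
- by move=> j; exact: limit_block_measurable.
- by move=> j w _; exact: limit_block_ge0.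
apply: (@le_trans _ _ ((n.+1%:R ^- 4)%:E *
   ((C * (n.+1 ^ 2)%:R)%:E + \sum_(j < 2 * n + 4) (C * (4 * n.+1)%:R)%:E))%E).
  apply: lee_wpmul2l; first by rewrite lee_fin invr_ge0 exprn_ge0.
  apply: leeD; first by have := @integral_limit_block_le 0 (n.+1 ^ 2) (leq0n _); rewrite subn0.
  apply: lee_sum => j _; have := @integral_limit_block_le (n.+1 ^ 2) (n.+1 ^ 2 + j) (leq_addr _ _).
  move=> /le_trans; apply; rewrite lee_fin ler_wpM2l // ler_nat addKn.
  by have := ltn_ord j; lia.
rewrite sumEFin big_const_ord iter_addr_0 -EFinD -EFinM lee_fin.
have -> : (C * (n.+1 ^ 2)%:R + C * (4 * n.+1)%:R *+ (2 * n + 4) : R) =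
    C * ((n.+1 ^ 2)%:R + (4 * n.+1 * (2 * n + 4))%:R).
  by rewrite -mulr_natr !natrM; ring.
apply: (@le_trans _ _ (n.+1%:R ^- 4 * (C * (17 * n.+1 ^ 2)%:R))).
  rewrite ler_wpM2l ?invr_ge0 ?exprn_ge0 // ler_wpM2l // -natrD ler_nat.
  nia.
have -> : n.+2%:R = n.+1%:R + 1 :> R by rewrite -natr1.
rewrite natrM natrX; have : 1 <= n.+1%:R :> R by rewrite ler1n.
move: (n.+1%:R) n0 => x x0 x1.
have -> : x ^- 4 * (C * (17 * x ^+ 2)) = C * (17 / x ^+ 2) by field; lra.
have -> : 34 * C * (x^-1 - (x + 1)^-1) = C * (34 / (x * (x + 1))) by field; lra.
rewrite ler_wpM2l // ler_pdivrMr ?exprn_gt0 // mulrAC ler_pdivlMr ?mulr_gt0 ?addr_gt0 //.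
by nra.
Qed.

Lemma ae_scaled_block_summable : {ae Pr, forall w, \sum_(n <oo) scaled_block n w < +oo}%E.
Proof.
have mS : measurable_fun setT (fun w => \sum_(n <oo) scaled_block n w)%E.
  by apply: (ge0_emeasurable_sum (P := xpredT)) => // n *;
    [exact: scaled_block_ge0|exact: scaled_block_measurable].
have iS : Pr.-integrable setT (fun w => \sum_(n <oo) scaled_block n w)%E.
  apply/integrableP; split=> //.
  have abs_sum w : (`|\sum_(n <oo) scaled_block n w| = \sum_(n <oo) scaled_block n w)%E.
    by rewrite gee0_abs // nneseries_ge0 // => n _ _; exact: scaled_block_ge0.
  under eq_integral do rewrite abs_sum.
  rewrite integral_nneseries //; last 2 first.
  - exact: scaled_block_measurable.
  - by move=> n w _; exact: scaled_block_ge0.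
  apply: (@le_lt_trans _ _ (34 * C)%:E); last exact: ltry.
  apply: lime_le.
    by apply: is_cvg_nneseries => n _ _; apply: integral_ge0 => w _; exact: scaled_block_ge0.
  apply: nearW => n.
  apply: (@le_trans _ _ (\sum_(0 <= i < n) (34 * C * (i.+1%:R^-1 - i.+2%:R^-1))%:E)%E).
    by apply: lee_sum => i _; exact: integral_scaled_block_le.
  rewrite sumEFin lee_fin -mulr_sumr -[leRHS]mulr1 ler_wpM2l ?mulr_ge0 //.
  have -> : \sum_(0 <= i < n) (i.+1%:R^-1 - i.+2%:R^-1) = 1 - n.+1%:R^-1 :> R.
    elim: n => [|n IH]; first by rewrite big_geq // invr1 subrr.
    by rewrite big_nat_recr //= IH; ring.
  by rewrite gerBl invr_ge0.
have := integrable_ae measurableT iS; apply: filterS => w /(_ I).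
by rewrite fin_numElt => /andP[].
Qed.

Lemma isqrt_exists m : exists r, (r ^ 2 <= m < r.+1 ^ 2)%N.
Proof.
elim: m => [|m [r /andP[r1 r2]]]; first by exists 0%N.
have [lt|ge] := ltnP m.+1 (r.+1 ^ 2)%N; first by exists r; rewrite lt andbT; lia.
by exists r.+1; rewrite ge /=; nia.
Qed.

(** Almost everywhere the nonnegative terms [scaled_block n] have a finite sum, hence tend to 0.
    With [m] visits and [r ^ 2 <= m < (r + 1) ^ 2], the sum is split at visit number [r ^ 2]; both
    pieces occur in one scaled term, and [r ^ 4 <= m ^ 2] compares the normalisations. *)
Theorem martingale_LLN : {ae Pr, forall w,
  (forall M, \forall k \near \oo, (M <= nvisits k w)%N) ->
  (\sum_(i < k) D i w) / (nvisits k w)%:R @[k --> \oo] --> 0}.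
Proof.
apply: filterS ae_scaled_block_summable => w Sw Ninf.
apply/cvgr0Pnorm_le => e e0.
(* The factor 1/2 anticipates [(x + y) ^ 2 <= 2 * (x ^ 2 + y ^ 2)]. *)
have [r0 Hr0] : exists r0, forall r, (r0 <= r)%N -> (scaled_block r w <= (e ^+ 2 / 2)%:E)%E.
  have e20 : (0 < (e ^+ 2 / 2)%:E :> \bar R)%E by rewrite lte_fin divr_gt0 // exprn_gt0.
  have := nneseries_tail_cvg Sw (fun n _ => scaled_block_ge0 n w).
  move=> /fine_cvgP[Hf /cvgr_le/(_ _ e20)].
  case: Hf => r1 _ Hf [r2 _ Hr2]; exists (maxn r1 r2) => r.
  rewrite geq_max => /andP[/Hf /= fr /Hr2 /= le_r].
  rewrite -(fineK fr) in le_r *.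
  apply: (@le_trans _ _ (\sum_(r <= k <oo) scaled_block k w)%E).
    rewrite (nneseries_split _ 1); last by move=> *; exact: scaled_block_ge0.
    rewrite addn1 big_nat1; apply: leeDl; apply: nneseries_ge0 => *; exact: scaled_block_ge0.
  by rewrite -(fineK fr) lee_fin.
have [K _ HK] := Ninf (r0.+1 ^ 2)%N; exists K => // k /= /HK /= mk.
set m := nvisits k w in mk *.
have [r /andP[r1 r2]] := isqrt_exists m.
have r0r : (r0 < r)%N by rewrite -ltnS -(ltn_exp2r _ _ (isT : 0 < 2)%N); apply: leq_ltn_trans mk r2.
(* From here on the integer square root of [m] is written [r.+1], matching the index of
   [scaled_block]. *)
case: r => [//|r] in r1 r2 r0r *.
have m0 : 0 < m%:R :> R by rewrite ltr0n; apply: leq_trans r1; rewrite expn_gt0.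
have rp : 0 < r.+1%:R :> R by rewrite ltr0n.
have rm : r.+1%:R ^+ 2 <= m%:R :> R by rewrite -natrX ler_nat.
have := Hr0 r (ltnSE r0r).
(* Consecutive squares differ by [2 * r + 3], so the offset of [m] is among those summed in
   [scaled_block]. *)
have jm : (m - r.+1 ^ 2 < 2 * r + 4)%N by nia.
rewrite /scaled_block (@limit_blockE 0 _ k) //.
rewrite (bigD1 (Ordinal jm)) //= subnKC // (@limit_blockE _ m k) //.
set x := block _ _ _ _; set y := block _ _ _ _ => Hxy.
have {}Hxy : x ^+ 2 + y ^+ 2 <= r.+1%:R ^+ 4 * (e ^+ 2 / 2).
  rewrite mulrC -ler_pdivrMr ?exprn_gt0 // -lee_fin; apply: le_trans Hxy.
  rewrite mulrC EFinM; apply: lee_wpmul2l; first by rewrite lee_fin invr_ge0 exprn_ge0.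
  rewrite EFinD leeD2l // leeDl // sume_ge0 // => *; exact: limit_block_ge0.
have -> : \sum_(i < k) D i w = x + y.
  by rewrite -block_total -/m (@block_split 0 (r.+1 ^ 2) m).
rewrite normrM normfV (gtr0_norm m0) ler_pdivrMr //.
rewrite -ler_sqr ?nnegrE ?mulr_ge0 ?(ltW e0) // real_normK ?num_real //.
have rm4 : r.+1%:R ^+ 4 <= m%:R ^+ 2 :> R.
  by rewrite (_ : 4 = 2 * 2)%N // exprM lerXn2r // nnegrE -?natrX ler0n.
have : r.+1%:R ^+ 4 * e ^+ 2 <= m%:R ^+ 2 * e ^+ 2 by rewrite ler_wpM2r ?sqr_ge0.
have := sqr_ge0 (x - y); rewrite exprMn; lra.
Qed.
End LLN.
End SubSigma.

(** * Measurability of limits, finite partitions, conditional laws *)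

Section MeasureFacts.
Context {R : realType} {d : measure_display} {T : measurableType d}.

Lemma einfs_le_seq (u : nat -> \bar R) n : (einfs u n <= u n)%E.
Proof. by apply: ereal_inf_lbound; exists n => /=. Qed.

Lemma seq_le_esups (u : nat -> \bar R) n : (u n <= esups u n)%E.
Proof. by apply: ereal_sup_ubound; exists n => /=. Qed.

(* [limn u] is the junk value [point] when [u] diverges, so measurability needs
   the set of convergence to be measurable. *)
Lemma limn_EFinE (u : nat -> R) :
  limn u = (if (limn_esup (EFin \o u) == limn_einf (EFin \o u)) &&
              (limn_esup (EFin \o u) \is a fin_num)
           then fine (limn_esup (EFin \o u)) else point).
Proof.
have [cu|ncu] := pselect (cvgn u).
  have : (EFin \o u) n @[n --> \oo] --> (limn u)%:E.
    by apply/fine_cvgP; split; [exact: nearW|exact: cu].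
  by move=> /cvg_limn_einf_sup[-> ->]; rewrite eqxx.
rewrite (dvgP ncu); case: ifPn => // /andP[/eqP E f].
exfalso; apply: ncu; apply/cvg_ex; exists (fine (limn_esup (EFin \o u))).
suff /fine_cvgP[] : (EFin \o u) n @[n --> \oo] --> (fine (limn_esup (EFin \o u)))%:E by [].
rewrite (fineK f); apply: (@squeeze_cvge _ _ _ _ (einfs (EFin \o u)) _ (esups (EFin \o u))).
- by apply: nearW => n; rewrite einfs_le_seq seq_le_esups.
- by rewrite E limn_einf_lim; exact: is_cvg_einfs.
- by rewrite limn_esup_lim; exact: is_cvg_esups.
Qed.

Lemma measurable_fun_limn (h : nat -> T -> R) :
  (forall n, measurable_fun setT (h n)) ->
  measurable_fun setT (fun x => limn (fun n => h n x)).
Proof.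
move=> mh; under eq_fun => x do rewrite limn_EFinE.
pose u n x := (h n x)%:E.
have mu n : measurable_fun setT (u n) by exact/measurable_EFinP.
have ms : measurable_fun setT (fun x => limn_esup (fun n => u n x)).
  exact: measurable_fun_limn_esup.
have mi : measurable_fun setT (fun x => limn_einf (fun n => u n x)).
  rewrite (_ : (fun x => _) = (fun x => - limn_esup (fun n => - u n x))%E); last first.
    by apply/funext => w; rewrite -limn_einfN; f_equal; apply/funext => k; rewrite /comp oppeK.
  apply: measurableT_comp => //; apply: measurable_fun_limn_esup => k.
  exact: measurableT_comp.
apply: measurable_fun_ifT => //; last exact: measurableT_comp.
apply: measurable_and; first exact: measurable_fun_eqe.
apply: (measurable_fun_bool true); exact: emeasurable_fin_num.
Qed.

(** Serves for quantities read off at a first-visit time, a visit count or a policy code, all of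
    which take countably many values. *)
Lemma measurable_fun_case (I : countType) (tau : T -> I) (g : I -> T -> R) :
  (forall i, measurable [set w | tau w = i]) ->
  (forall i, measurable_fun setT (g i)) ->
  measurable_fun setT (fun w => g (tau w) w).
Proof.
move=> mt mg _ U mU; rewrite setTI.
have -> : (fun w => g (tau w) w) @^-1` U = \bigcup_i ([set w | tau w = i] `&` (g i @^-1` U)).
  apply/seteqP; split=> w /= => [Uw|[i _ [<-]] //]; by exists (tau w).
apply: countable_bigcupT_measurable => [|i]; first exact: countableP.
by apply: measurableI => //; rewrite -[X in measurable X]setTI; exact: mg.
Qed.

Variable mu : {measure set T -> \bar R}.

Section Partition.
Variables (I : finType) (phi : T -> I).
Hypothesis mphi : forall i, measurable [set w | phi w = i].

Lemma setI_partition (E : set T) :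
  E = \big[setU/set0]_(i <- index_enum I) (E `&` [set w | phi w = i]).
Proof.
apply/seteqP; split=> w.
  by move=> Ew; rewrite (bigD1_seq (phi w)) ?mem_index_enum ?index_enum_uniq //=; left.
by rewrite -bigcup_seq => -[i _ []].
Qed.

Let triv (E : set T) : trivIset [set` index_enum I] (fun i => E `&` [set w | phi w = i]).
Proof.
apply/trivIsetP => i j _ _ ij; apply/seteqP; split=> w // -[[_ /= iE] [_ /= jE]].
by move: ij; rewrite -iE -jE eqxx.
Qed.

Lemma integral_partition (E : set T) (f : T -> R) : measurable E -> measurable_fun setT f ->
  (\int[mu]_(w in E) (f w)%:E =
   \sum_i \int[mu]_(w in E `&` [set w | phi w = i]) (f w)%:E)%E.
Proof.
move=> mE mf; rewrite {1}[E]setI_partition integral_bigsetU_EFin //.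
- by move=> i; exact: measurableI.
- exact: index_enum_uniq.
- rewrite -[X in measurable_fun X _]setI_partition; apply/measurable_EFinP; exact: measurable_funTS.
Qed.
Lemma measure_partition (E : set T) : measurable E ->
  (mu E = \sum_i mu (E `&` [set w | phi w = i]))%E.
Proof.
move=> mE; have mu1 (A : set T) : measurable A -> (mu A = \int[mu]_(w in A) (1 : R)%:E)%E.
  by move=> mA; rewrite -[LHS]mul1e; apply/esym; exact: integral_cst.
rewrite mu1 // (@integral_partition _ (fun=> 1)) //; apply: eq_bigr => i _.
by rewrite -mu1 //; exact: measurableI.
Qed.
End Partition.

Section ConditionalLaw.
Variables (P : probability T R) (E : set T) (f : T -> R) (m : probability R R).
Hypotheses (mE : measurable E) (mf : measurable_fun setT f).
Hypothesis law : forall U, measurable U -> (P (E `&` f @^-1` U) = P E * m U)%E.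

(** The image under [f] of [P] restricted to [E] is [m] scaled by the mass of [E]; the formula is a
    change of variables. *)
Lemma ge0_integral_law (g : R -> \bar R) : measurable_fun setT g -> (forall r, 0 <= g r)%E ->
  (\int[P]_(w in E) g (f w) = P E * \int[m]_r g r)%E.
Proof.
move=> mg g0.
have PE0 : 0 <= fine (P E) by rewrite fine_ge0.
have PEf : P E \is a fin_num by exact: fin_num_measure.
transitivity (\int[pushforward (mrestr P mE) f]_(r in setT) g r)%E.
  rewrite ge0_integral_pushforward //= preimage_setT.
  rewrite (@ge0_negligible_integral _ _ _ (mrestr P mE) _ (~` E)) //.
  - rewrite setTD setCK; apply: eq_measure_integral => A mA AE.
    by rewrite -[in LHS](setIidl AE).
  - exact: measurableC.
  - exact: measurableT_comp.
  - transitivity (P (~` E `&` E)); first by [].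
    by rewrite setICl measure0.
rewrite (@eq_measure_integral _ _ _ _ (mscale (NngNum PE0) m)).
  by rewrite ge0_integral_mscale //= fineK.
move=> A mA _; transitivity ((fine (P E))%:E * m A)%E; last by [].
by rewrite fineK // -law // setIC.
Qed.

Lemma integral_law : m.-integrable setT EFin ->
  (\int[P]_(w in E) (f w)%:E = P E * \int[m]_r r%:E)%E.
Proof.
move=> im; rewrite integralE [in RHS]integralE.
have mp : measurable_fun [set: R] (fun r : R => maxe r%:E 0%E).
  by apply: measurable_maxe => //; exact/measurable_EFinP.
have mn : measurable_fun [set: R] (fun r : R => maxe (- r%:E)%E 0%E).
  by apply: measurable_maxe => //; apply: measurableT_comp => //; exact/measurable_EFinP.
under eq_integral do rewrite funeposE.
under [X in (_ - X)%E]eq_integral do rewrite funenegE.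
under [X in (_ * (X - _))%E]eq_integral do rewrite funeposE.
under [X in (_ * (_ - X))%E]eq_integral do rewrite funenegE.
rewrite (ge0_integral_law mp); last by move=> r; rewrite le_max lexx orbT.
rewrite (ge0_integral_law mn); last by move=> r; rewrite le_max lexx orbT.
have PEf : P E \is a fin_num by exact: fin_num_measure.
have pf : (\int[m]_r maxe r%:E 0 \is a fin_num)%E.
  by have := integrable_pos_fin_num measurableT im; under eq_integral do rewrite funeposE.
have nf : (\int[m]_r maxe (- r%:E) 0 \is a fin_num)%E.
  by have := integrable_neg_fin_num measurableT im; under eq_integral do rewrite funenegE.
by rewrite [RHS]muleBr // fin_num_adde_defr.
Qed.
End ConditionalLaw.
End MeasureFacts.

(** * The law of the algorithm *)

Section AlgorithmLaw.
Context {R : realType} {X Act : finType} {d : measure_display} {Omega : measurableType d}.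
Variables (Aset : X -> {set Act}) (Pt : X -> Act -> X -> R).
Variables (S : X -> Act -> X -> probability R R) (gamma theta : R) (mu0 : X -> R).
Variable Pr : probability Omega R.
Variables (Xs : nat -> nat -> Omega -> X) (As : nat -> nat -> Omega -> Act).
Variable Rs : nat -> nat -> Omega -> R.

Hypothesis mXs : forall i t y, measurable (Xs i t @^-1` [set y]).
Hypothesis mAs : forall i t b, measurable (As i t @^-1` [set b]).
Hypothesis mRs : forall i t, measurable_fun setT (Rs i t).

(** The generators of [past_sigma], kept apart so that they can equip [Omega] with the measurable
    structure of the past. *)
Definition past_gen (k : nat) : set (set Omega) :=
  [set E | exists i t, (i < k)%N /\
        ((exists y, E = Xs i t @^-1` [set y]) \/
         (exists b, E = As i t @^-1` [set b]) \/
         (exists U : set R, measurable U /\ E = Rs i t @^-1` U))].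

Local Notation past_type k := (g_sigma_algebraType (past_gen k)).

Lemma past_gen_measurable k : past_gen k `<=` measurable.
Proof.
move=> E [i [t [_ [[y ->]|[[b ->]|[U [mU ->]]]]]]] //.
by rewrite -[X in measurable X]setTI; exact: mRs.
Qed.

Lemma past_gen_mono k : past_gen k `<=` past_gen k.+1.
Proof. by move=> E [i [t [ik H]]]; exists i, t; split=> //; exact: leqW. Qed.

Lemma past_X i t y k : (i < k)%N -> <<s past_gen k >> (Xs i t @^-1` [set y]).
Proof. by move=> ik; apply: sub_gen_smallest; exists i, t; split=> //; left; exists y. Qed.

Lemma past_A i t b k : (i < k)%N -> <<s past_gen k >> (As i t @^-1` [set b]).
Proof. by move=> ik; apply: sub_gen_smallest; exists i, t; split=> //; right; left; exists b. Qed.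

Lemma past_R i t k : (i < k)%N -> adapted (past_gen k) (Rs i t).
Proof.
move=> ik _ U mU; rewrite setTI; apply: sub_gen_smallest; exists i, t; split=> //.
by right; right; exists U.
Qed.

Definition fvisit (i : nat) (x : X) (a : Act) (w : Omega) : option nat :=
  first_visit (fun i t => Xs i t w) (fun i t => As i t w) i x a.

Definition visit_at (i t : nat) (x : X) (a : Act) : set Omega :=
  [set w | Xs i t w = x /\ As i t w = a].

Lemma fvisit_Some i x a s : [set w | fvisit i x a w = Some s] =
  visit_at i s x a `&` \bigcap_(t in [set t | (t < s)%N]) ~` visit_at i t x a.
Proof.
apply/seteqP; split=> w; rewrite /fvisit /first_visit /=.
  case: pselect => // e [<-]; case: ex_minnP => n /andP[/eqP Xn /eqP An] Hn.
  split=> // t /= tn [/eqP Xt /eqP At].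
  by have := Hn t; rewrite Xt At => /(_ isT); rewrite leqNgt tn.
move=> [[/eqP Xn /eqP An] Hs]; case: pselect => [e|]; last first.
  by case; exists s; rewrite Xn An.
congr Some; case: ex_minnP => n /andP[/eqP Xn' /eqP An'] Hn.
apply/eqP; rewrite eqn_leq Hn ?Xn ?An //= leqNgt; apply/negP => ns.
exact: (Hs n ns).
Qed.

Lemma fvisit_None i x a : [set w | fvisit i x a w = None] =
  \bigcap_t ~` visit_at i t x a.
Proof.
apply/seteqP; split=> w; rewrite /fvisit /first_visit /=; case: pselect => //.
  by move=> ne _ t _ [/eqP Xt /eqP At]; apply: ne; exists t; rewrite Xt At.
by move=> [t /andP[/eqP Xt /eqP At]] /(_ t I) [].
Qed.

Lemma past_fvisit i x a o k : (i < k)%N -> <<s past_gen k >> [set w | fvisit i x a w = o].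
Proof.
move=> ik; have V t : <<s past_gen k >> (visit_at i t x a).
  have -> : visit_at i t x a = (Xs i t @^-1` [set x]) `&` (As i t @^-1` [set a]) by [].
  by apply: (@measurableI _ (past_type k)); [exact: past_X|exact: past_A].
have CV t : <<s past_gen k >> (~` visit_at i t x a) by exact: sigma_algebraC.
case: o => [s|]; rewrite ?fvisit_Some ?fvisit_None.
  apply: (@measurableI _ (past_type k)); first exact: V.
  exact: (@bigcap_measurableType _ (past_type k) (fun t => ~` visit_at i t x a) _ (fun t _ => CV t)).
exact: (@bigcap_measurableType _ (past_type k) (fun t => ~` visit_at i t x a) _ (fun t _ => CV t)).
Qed.

Definition visited (x : X) (a : Act) (i : nat) (w : Omega) : bool := fvisit i x a w != None.

Lemma past_visited x a i k : (i < k)%N -> <<s past_gen k >> [set w | visited x a i w].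
Proof.
move=> ik; have -> : [set w | visited x a i w] = ~` [set w | fvisit i x a w = None].
  by apply/seteqP; split=> w /= /eqP.
by apply: sigma_algebraC; exact: past_fvisit.
Qed.

Definition fvreturn (i : nat) (x : X) (a : Act) (w : Omega) : R :=
  first_visit_return (fun i t => Xs i t w) (fun i t => As i t w) (fun i t => Rs i t w)
    gamma i x a.

(** Reading the reward as 0 when there is no visit turns the first-visit return into a single series
    on all paths. *)
Definition vreward (i : nat) (x : X) (a : Act) (t : nat) (w : Omega) : R :=
  if fvisit i x a w is Some s then Rs i (s + t) w else 0.

Lemma past_vreward i x a t k : (i < k)%N -> adapted (past_gen k) (vreward i x a t).
Proof.
move=> ik; apply: (@measurable_fun_case _ _ (past_type k) _ (fvisit i x a)
  (fun o w => if o is Some s then Rs i (s + t) w else 0)).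
- by move=> o; exact: past_fvisit.
- by case=> [s|]; [exact: past_R|exact: measurable_cst].
Qed.

Lemma fvreturnE i x a w :
  fvreturn i x a w = limn (fun n => \sum_(0 <= t < n) gamma ^+ t * vreward i x a t w).
Proof.
rewrite /fvreturn /first_visit_return /vreward -/(fvisit i x a w).
case: (fvisit i x a w) => //.
rewrite (_ : (fun n => _) = fun=> 0) ?lim_cst //; apply/funext => n.
by rewrite big1 // => *; rewrite mulr0.
Qed.

Lemma past_fvreturn i x a k : (i < k)%N -> adapted (past_gen k) (fvreturn i x a).
Proof.
move=> ik; rewrite (funext (fvreturnE i x a)).
apply: (@measurable_fun_limn _ _ (past_type k)) => n.
apply: measurable_sum => t; apply: measurable_funM; first exact: measurable_cst.
exact: past_vreward.
Qed.

Lemma past_nvisits x a k n : <<s past_gen k >> [set w | nvisits (visited x a) k w = n].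
Proof.
apply: nvisits_meas; first exact: past_gen_mono.
by move=> i; exact: past_visited.
Qed.

Lemma past_comp_nvisits x a k (f : nat -> R) :
  adapted (past_gen k) (fun w => f (nvisits (visited x a) k w)).
Proof.
apply: (@measurable_fun_case _ _ (past_type k) _ (nvisits (visited x a) k) (fun n _ => f n)).
- by move=> n; exact: past_nvisits.
- by move=> n; exact: measurable_cst.
Qed.

Definition Qhat (k : nat) (x : X) (a : Act) (w : Omega) : R :=
  Qbar (fun i t => Xs i t w) (fun i t => As i t w) (fun i t => Rs i t w) gamma k x a.

Lemma QhatE k x a w : Qhat k x a w =
  (\sum_(i < k) fvreturn i x a w) / (nvisits (visited x a) k w)%:R.
Proof. by []. Qed.

Lemma past_Qhat k x a : adapted (past_gen k) (Qhat k x a).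
Proof.
rewrite (funext (QhatE k x a)); apply: measurable_funM; last first.
  exact: (@past_comp_nvisits x a k (fun n => n%:R^-1)).
have H (i : 'I_k) : adapted (past_gen k) (fvreturn i x a) by exact: past_fvreturn.
exact: measurable_sum.
Qed.

Definition nstate (k : nat) (x : X) (w : Omega) : nat :=
  visits_state Aset (fun i t => Xs i t w) (fun i t => As i t w) k x.

Lemma nstateE k x w : nstate k x w = (\sum_(a in Aset x) nvisits (visited x a) k w)%N.
Proof. by []. Qed.

Lemma past_nstate k x n : <<s past_gen k >> [set w | nstate k x w = n].
Proof.
have m : adapted (past_gen k) (fun w => (nstate k x w)%:R : R).
  have -> : (fun w => (nstate k x w)%:R : R) = fun w =>
      \sum_a (if a \in Aset x then (nvisits (visited x a) k w)%:R else 0) :> R.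
    by apply/funext => w; rewrite nstateE natr_sum big_mkcond.
  apply: measurable_sum => a; case: (a \in Aset x); last exact: measurable_cst.
  exact: (@past_comp_nvisits x a k (fun n => n%:R)).
have := m measurableT [set n%:R] (measurable_set1 _); rewrite setTI.
rewrite (_ : _ @^-1` _ = [set w | nstate k x w = n]) //.
apply/seteqP; split=> w /=; last by move=> ->.
by move/eqP; rewrite eqr_nat => /eqP.
Qed.

Lemma nstate_le k x w : (nstate k x w <= k * #|Act|)%N.
Proof.
rewrite nstateE mulnC; apply: (@leq_trans (\sum_(a in Aset x) k)%N).
  apply: leq_sum => a _; apply: (@leq_trans (\sum_(i < k) 1)%N).
    by apply: leq_sum => i _; case: (visited _ _ _ _).
  by rewrite sum1_card card_ord.
by rewrite sum_nat_const leq_mul2r max_card orbT.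
Qed.

Definition greedy (k : nat) (x : X) (w : Omega) : {set Act} :=
  argmaxQ Aset (fun i t => Xs i t w) (fun i t => As i t w) (fun i t => Rs i t w) gamma k x.

Lemma past_greedy k x A : <<s past_gen k >> [set w | greedy k x w = A].
Proof.
have le a b : <<s past_gen k >> [set w | Qhat k x b w <= Qhat k x a w].
  have : measurable_fun [set: past_type k] (fun w : past_type k => Qhat k x b w <= Qhat k x a w).
    by apply: measurable_fun_ler; exact: past_Qhat.
  by move=> /(_ measurableT [set true]); rewrite setTI; apply.
have ina a : <<s past_gen k >> [set w | a \in greedy k x w].
  have -> : [set w | a \in greedy k x w] = if a \in Aset x then
      \bigcap_(b in [set b | b \in Aset x]) [set w | Qhat k x b w <= Qhat k x a w] else set0.
    apply/seteqP; split=> w; rewrite /greedy /argmaxQ /= inE.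
      by move=> /andP[-> /forallP H] b /= bA; have := H b; rewrite bA.
    case: ifP => // aA H; apply/andP; split => //; apply/forallP => b.
    by apply/implyP => bA; exact: H.
  case: (a \in Aset x); last exact: (@measurable0 _ (past_type k)).
  apply: (@fin_bigcap_measurable _ (past_type k)) => [|b _]; [exact: finite_finset|exact: le].
have -> : [set w | greedy k x w = A] =
    \bigcap_a (if a \in A then [set w | a \in greedy k x w]
               else ~` [set w | a \in greedy k x w]).
  apply/seteqP; split=> w /= => [<- a _|H].
    by case: ifP => // /negP.
  by apply/setP => a; have := H a I; case: ifP => //= _ /negP/negbTE.
apply: (@fin_bigcap_measurable _ (past_type k)) => [|a _]; first exact: finite_finset.
by case: (a \in A); [exact: ina|apply: sigma_algebraC; exact: ina].
Qed.

(* The policy of episode k takes finitely many values, indexed by the greedy sets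
   and the visit counts: conditioning on the past reduces to finite sums. *)
Definition code (k : nat) (w : Omega) : {ffun X -> {set Act} * 'I_(k * #|Act|).+1} :=
  [ffun x => (greedy k x w, inord (nstate k x w))].

Definition code_policy k (c : {ffun X -> {set Act} * 'I_(k * #|Act|).+1}) : X -> Act -> R :=
  fun x a => let e := (1 + (c x).2%:R) `^ (- theta) in
  if a \in Aset x then
    e / #|Aset x|%:R + (a \in (c x).1)%:R * (1 - e) / #|(c x).1|%:R
  else 0.

Local Notation pik w k := (pibar_at Aset Xs As Rs gamma theta w k).

Lemma code_policyE k w : code_policy (code k w) = pik w k.
Proof.
apply/funext => x; apply/funext => a; rewrite /code_policy ffunE /=.
by rewrite inordK // ltnS nstate_le.
Qed.

Lemma past_code k c : <<s past_gen k >> [set w | code k w = c].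
Proof.
have -> : [set w | code k w = c] = \bigcap_x
   ([set w | greedy k x w = (c x).1] `&` [set w | nstate k x w = (c x).2]).
  apply/seteqP; split=> w /= => [<- x _ /=|H].
    by rewrite ffunE /= inordK // ltnS nstate_le.
  apply/ffunP => x; rewrite ffunE; have [/= -> ->] := H x I.
  by rewrite inord_val; case: (c x).
apply: (@fin_bigcap_measurable _ (past_type k)) => [|x _]; first exact: finite_finset.
by apply: (@measurableI _ (past_type k)); [exact: past_greedy|exact: past_nstate].
Qed.

Hypothesis Aset_gt0 : forall x, (0 < #|Aset x|)%N.
Hypothesis PtP : forall x a, a \in Aset x ->
  (forall y, 0 <= Pt x a y) /\ \sum_(y : X) Pt x a y = 1.
Hypothesis S_moment : forall x a y, a \in Aset x ->
  (\int[S x a y]_r ((r ^+ 2)%:E) < +oo)%E.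
Hypotheses (gamma_ge0 : 0 <= gamma) (gamma_lt1 : gamma < 1) (theta_gt0 : 0 < theta).
Hypothesis law : forall k T ys bs Us B, (forall t, measurable (Us t)) ->
  past_sigma Xs As Rs k B ->
  Pr (B `&` cyl_event Xs As Rs k T ys bs Us)
  = (\int[Pr]_(w in B) (path_weight Pt S (pik w k) mu0 T ys bs Us)%:E)%E.

(** Inadmissible actions may have infinite second moments; [fine] sends these to 0, so the sum is a
    real number that still dominates every admissible term. *)
Definition second_moment : R :=
  \sum_x \sum_a \sum_y fine (\int[S x a y]_r ((r ^+ 2)%:E))%E.

Lemma second_moment_ge0 : 0 <= second_moment.
Proof.
by do 3 (apply: sumr_ge0 => ? _); apply: fine_ge0; apply: integral_ge0 => r _; rewrite lee_fin sqr_ge0.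
Qed.

Lemma second_moment_ge x a y : a \in Aset x ->
  (\int[S x a y]_r ((r ^+ 2)%:E) <= second_moment%:E)%E.
Proof.
move=> aA; have f0 x' a' y' : 0 <= fine (\int[S x' a' y']_r ((r ^+ 2)%:E))%E.
  by apply: fine_ge0; apply: integral_ge0 => r _; rewrite lee_fin sqr_ge0.
rewrite -[leLHS]fineK; last first.
  by rewrite ge0_fin_numE ?S_moment //; apply: integral_ge0 => r _; rewrite lee_fin sqr_ge0.
rewrite lee_fin /second_moment (bigD1 x) //= (bigD1 a) //= (bigD1 y) //=.
by rewrite -!addrA lerDl !addr_ge0 //; repeat (apply: sumr_ge0 => ? _) => //.
Qed.

Lemma S_integrable x a y : a \in Aset x -> (S x a y).-integrable setT EFin.
Proof.
move=> aA; have := @sq_integrable_integrable _ _ _ (S x a y) idfun; apply.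
by split; [exact: measurable_id|exact: S_moment].
Qed.

Definition upd (I : Type) (f : nat -> I) (n : nat) (v : I) : nat -> I :=
  fun m => if m == n then v else f m.

(** * One episode, restricted to a past event that fixes its policy *)

Section Episode.
Variables (k : nat) (p : X -> Act -> R) (B : set Omega).
Hypotheses (pastB : <<s past_gen k >> B) (Bp : forall w, B w -> pik w k = p).
Hypothesis sp : stochastic Aset p.

Local Notation cyl T ys bs := (cyl_event Xs As Rs k T ys bs (fun=> setT)).
Local Notation weight T ys bs := (path_weight Pt S p mu0 T ys bs (fun=> setT)).
Local Notation ER := (exp_reward Aset Pt S (sm_policy p)).

Lemma measurable_B : measurable B.
Proof. exact: (sub_sigma_measurable (@past_gen_measurable k)). Qed.

Lemma cyl_event_measurable T ys bs Us : (forall t, measurable (Us t)) ->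
  measurable (cyl_event Xs As Rs k T ys bs Us).
Proof.
move=> mU; have -> : cyl_event Xs As Rs k T ys bs Us =
   (\bigcap_(t in [set t | (t <= T)%N]) (Xs k t @^-1` [set ys t])) `&`
   (\bigcap_(t in [set t | (t < T)%N]) (As k t @^-1` [set bs t] `&` Rs k t @^-1` Us t)) by [].
apply: measurableI; apply: bigcap_measurableType => t _ //.
by apply: measurableI => //; rewrite -[X in measurable X]setTI; exact: mRs.
Qed.

Lemma measurable_Bcyl T ys bs : measurable (B `&` cyl T ys bs).
Proof. by apply: measurableI; [exact: measurable_B|exact: cyl_event_measurable]. Qed.

Lemma Pr_cyl_event T ys bs Us : (forall t, measurable (Us t)) ->
  (Pr (B `&` cyl_event Xs As Rs k T ys bs Us) =
   (path_weight Pt S p mu0 T ys bs Us)%:E * Pr B)%E.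
Proof.
move=> mU; rewrite law //; transitivity (\int[Pr]_(w in B) (path_weight Pt S p mu0 T ys bs Us)%:E)%E.
  by apply: eq_integral => w; rewrite inE => /Bp ->.
by apply: integral_cst; exact: measurable_B.
Qed.

Lemma weightS T ys bs : weight T.+1 ys bs =
  weight T ys bs * (p (ys T) (bs T) * Pt (ys T) (bs T) (ys T.+1)).
Proof.
by rewrite /path_weight big_ord_recr /= mulrA probability_setT /= mulr1.
Qed.

(** Only the reward set at time [T] is varied in the cylinder formula, so all other factors of the
    path weight cancel. This is the product form from which integrals of the reward are computed. *)
Lemma cyl_reward_law T ys bs U : measurable U ->
  (Pr ((B `&` cyl T.+1 ys bs) `&` Rs k T @^-1` U) =
   Pr (B `&` cyl T.+1 ys bs) * S (ys T) (bs T) (ys T.+1) U)%E.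
Proof.
move=> mU; pose Us t := if t == T then U else setT.
have mUs t : measurable (Us t) by rewrite /Us; case: eqP.
have -> : (B `&` cyl T.+1 ys bs) `&` Rs k T @^-1` U =
          B `&` cyl_event Xs As Rs k T.+1 ys bs Us.
  apply/seteqP; split=> w.
    move=> [[Bw [H1 H2]] RU]; split=> //; split=> // t tT; have [H3 _] := H2 t tT.
    by split=> //; rewrite /Us; case: eqP => // ->.
  move=> [Bw [H1 H2]]; split; last by have [_] := H2 T (ltnSn T); rewrite /Us eqxx.
  by split=> //; split=> // t tT; split=> //; have [] := H2 t tT.
rewrite !Pr_cyl_event // muleAC; congr (_ * _)%E.
rewrite -[X in (_ * X)%E]fineK ?fin_num_measure // -EFinM weightS; congr EFin.
rewrite /path_weight big_ord_recr /= {2}/Us eqxx !mulrA; congr (_ * _ * _ * _).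
congr (_ * _); apply: eq_bigr => t _; rewrite /Us.
by rewrite (ltn_eqF (ltn_ord t)).
Qed.

Lemma weight_upd T ys bs b y : weight T (upd ys T.+1 y) (upd bs T b) = weight T ys bs.
Proof.
rewrite /path_weight /upd /=; congr (_ * _); apply: eq_bigr => t _.
have tT := ltn_ord t.
by rewrite !(ltn_eqF tT) !ltn_eqF // ltnS ltnW.
Qed.

Lemma Pr_cylS T ys bs b y :
  (Pr (B `&` cyl T.+1 (upd ys T.+1 y) (upd bs T b)) =
   (p (ys T) b * Pt (ys T) b y)%:E * Pr (B `&` cyl T ys bs))%E.
Proof.
rewrite !Pr_cyl_event // weightS weight_upd EFinM.
by rewrite /upd !eqxx ltn_eqF // [RHS]muleCA muleA.
Qed.

Definition step T w : Act * X := (As k T w, Xs k T.+1 w).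

Lemma step_measurable T i : measurable [set w | step T w = i].
Proof.
have -> : [set w | step T w = i] = As k T @^-1` [set i.1] `&` Xs k T.+1 @^-1` [set i.2].
  by case: i => b y; apply/seteqP; split=> w; rewrite /step /=; [case=> -> ->|move=> [-> ->]].
exact: measurableI.
Qed.

Lemma cyl_step T ys bs b y : (B `&` cyl T ys bs) `&` [set w | step T w = (b, y)] =
  B `&` cyl T.+1 (upd ys T.+1 y) (upd bs T b).
Proof.
apply/seteqP; split=> w /=; rewrite /step /cyl_event /upd /=.
  move=> [[Bw [H1 H2]] [Ab Xy]]; split=> //; split=> t tT.
    case: eqP => [-> //|/eqP ne]; apply: H1; lia.
  split=> //; case: eqP => [-> //|/eqP ne]; apply: (H2 t _).1; lia.
move=> [Bw [H1 H2]]; split.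
  split=> //; split=> t tT.
    by have := H1 t (leqW tT); rewrite ltn_eqF.
  by have := H2 t (leqW tT); rewrite ltn_eqF.
have := H1 T.+1 (leqnn _); have := H2 T (leqnn _); rewrite !eqxx => -[-> _] -> //.
Qed.

(** Expected reward [t] steps after the transition from [x] to [y] under [b]: the immediate reward
    depends on the whole transition, a later one on [y] only. *)
Definition next_reward t x b y : R :=
  if t is t'.+1 then ER t' [::] y else mean_reward S x b y.

Definition action_reward t x b : R := \sum_y Pt x b y * next_reward t x b y.

Lemma exp_reward_action t x :
  ER t [::] x = \sum_(a in Aset x) p x a * action_reward t x a.
Proof.
case: t => [//|t] /=; apply: eq_bigr => a _; congr (_ * _).
by apply: eq_bigr => y _; rewrite exp_reward_sm.
Qed.

(** The cylinder is cut by the action at time [T] and the state at [T + 1]; the cells have relative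
    mass [p] times [Pt], which reproduces the recursion of [exp_reward]. *)
Lemma integral_reward_step t T :
  (forall ys bs, \int[Pr]_(w in B `&` cyl T.+1 ys bs) (Rs k (T + t) w)%:E =
    Pr (B `&` cyl T.+1 ys bs) * (next_reward t (ys T) (bs T) (ys T.+1))%:E)%E ->
  (forall ys bs, \int[Pr]_(w in B `&` cyl T ys bs) (Rs k (T + t) w)%:E =
    Pr (B `&` cyl T ys bs) * (ER t [::] (ys T))%:E)%E.
Proof.
move=> H ys bs; rewrite (integral_partition _ (step_measurable T)) //; last exact: measurable_Bcyl.
have PF : Pr (B `&` cyl T ys bs) \is a fin_num.
  by apply: fin_num_measure; exact: measurable_Bcyl.
transitivity (\sum_(i : Act * X) (fine (Pr (B `&` cyl T ys bs)) *
    (p (ys T) i.1 * (Pt (ys T) i.1 i.2 * next_reward t (ys T) i.1 i.2)))%:E)%E.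
  apply: eq_bigr => -[b y] _; rewrite cyl_step H Pr_cylS /= -[X in (_ * X * _)%E]fineK //.
  by rewrite -!EFinM /upd !eqxx ltn_eqF //; congr EFin; ring.
rewrite sumEFin -mulr_sumr EFinM fineK //; congr (_ * _%:E)%E.
rewrite exp_reward_action.
rewrite -(pair_bigA _ (fun b y => p (ys T) b * (Pt (ys T) b y * next_reward t (ys T) b y))) /=.
rewrite [RHS]big_mkcond /=; apply: eq_bigr => b _; rewrite -mulr_sumr.
by case: ifPn => // nb; have [_ [-> //]] := sp (ys T); rewrite mul0r.
Qed.

Lemma Pr_cyl_inadmissible T ys bs : bs T \notin Aset (ys T) ->
  Pr (B `&` cyl T.+1 ys bs) = 0%E.
Proof.
move=> nb; rewrite Pr_cyl_event // weightS.
by have [_ [-> //]] := sp (ys T); rewrite mul0r mulr0 mul0e.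
Qed.

(** Induction on the delay [t] for all [T] at once: delay [t + 1] counted from [T] is delay [t]
    counted from [T + 1]. *)
Lemma integral_reward_next t T ys bs :
  (\int[Pr]_(w in B `&` cyl T.+1 ys bs) (Rs k (T + t) w)%:E =
    Pr (B `&` cyl T.+1 ys bs) * (next_reward t (ys T) (bs T) (ys T.+1))%:E)%E.
Proof.
elim: t T ys bs => [|t IH] T ys bs; last first.
  rewrite addnS -addSn; apply: integral_reward_step => ys' bs'; exact: IH.
(* Moments of rewards are assumed for admissible actions only; cylinders through other actions are
   null. *)
rewrite addn0 /=; have [bA|nb] := boolP (bs T \in Aset (ys T)); last first.
  rewrite Pr_cyl_inadmissible // mul0e; apply: null_set_integral.
  - exact: measurable_Bcyl.
  - by apply/measurable_EFinP; exact: measurable_funTS.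
  - exact: Pr_cyl_inadmissible.
rewrite (integral_law _ _ (fun U mU => cyl_reward_law T ys bs mU)) //.
- rewrite /mean_reward fineK //; exact: (integrable_fin_num measurableT (S_integrable _ bA)).
- exact: measurable_Bcyl.
- exact: S_integrable.
Qed.

Lemma integral_reward_sq_step t T :
  (forall ys bs, \int[Pr]_(w in B `&` cyl T.+1 ys bs) (Rs k (T + t) w ^+ 2)%:E <=
    second_moment%:E * Pr (B `&` cyl T.+1 ys bs))%E ->
  (forall ys bs, \int[Pr]_(w in B `&` cyl T ys bs) (Rs k (T + t) w ^+ 2)%:E <=
    second_moment%:E * Pr (B `&` cyl T ys bs))%E.
Proof.
move=> H ys bs; rewrite (@integral_partition _ _ _ _ _ _ (step_measurable T) _
  (fun w => Rs k (T + t) w ^+ 2)); last 2 first.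
- exact: measurable_Bcyl.
- exact: measurable_funX.
rewrite (measure_partition Pr (step_measurable T) (measurable_Bcyl T ys bs)).
rewrite ge0_sume_distrr; last by move=> *; exact: measure_ge0.
by apply: lee_sum => -[b y] _; rewrite cyl_step; exact: H.
Qed.

Lemma integral_reward_sq_next t T ys bs :
  (\int[Pr]_(w in B `&` cyl T.+1 ys bs) (Rs k (T + t) w ^+ 2)%:E <=
    second_moment%:E * Pr (B `&` cyl T.+1 ys bs))%E.
Proof.
elim: t T ys bs => [|t IH] T ys bs; last first.
  by rewrite addnS -addSn; apply: integral_reward_sq_step => ys' bs'; exact: IH.
rewrite addn0 /=; have [bA|nb] := boolP (bs T \in Aset (ys T)); last first.
  rewrite Pr_cyl_inadmissible // mule0 le_eqVlt; apply/orP; left; apply/eqP.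
  apply: null_set_integral.
  - exact: measurable_Bcyl.
  - by apply/measurable_EFinP; apply: measurable_funTS; exact: measurable_funX.
  - exact: Pr_cyl_inadmissible.
rewrite (@ge0_integral_law _ _ _ _ _ _ _ _ _ (fun U mU => cyl_reward_law T ys bs mU)
  (fun r => (r ^+ 2)%:E)) //.
- by rewrite muleC; apply: lee_wpmul2r => //; exact: second_moment_ge.
- exact: measurable_Bcyl.
- by apply/measurable_EFinP; exact: measurable_funX.
- by move=> r; rewrite lee_fin sqr_ge0.
Qed.

(** * Strong Markov property at the first visit *)

Section Visit.
Variables (x : X) (a : Act).
Hypothesis aA : a \in Aset x.

Definition first_at s : set Omega := B `&` [set w | fvisit k x a w = Some s].

(** The path before time [s] together with the state after it; the pair at time [s] is left out
    because on [first_at s] it is [(x, a)]. *)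
Definition hist s (w : Omega) : {ffun 'I_s -> X * Act} * X :=
  ([ffun j : 'I_s => (Xs k j w, As k j w)], Xs k s.+1 w).

(** The default [x] matters: at index [s], just beyond the recorded history, it supplies the state
    of the first visit. *)
Definition hist_state s (h : {ffun 'I_s -> X * Act}) (n : nat) : X :=
  if insub n is Some j then (h j).1 else x.

Definition hist_action s (h : {ffun 'I_s -> X * Act}) (n : nat) : Act :=
  if insub n is Some j then (h j).2 else a.

Lemma fvisit_measurable o : measurable [set w | fvisit k x a w = o].
Proof.
apply: (sub_sigma_measurable (@past_gen_measurable k.+1)); exact: past_fvisit.
Qed.

Lemma first_at_measurable s : measurable (first_at s).
Proof. by apply: measurableI; [exact: measurable_B|exact: fvisit_measurable]. Qed.

Lemma hist_measurable s i : measurable [set w | hist s w = i].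
Proof.
have -> : [set w | hist s w = i] =
   (\bigcap_(j : 'I_s) (Xs k j @^-1` [set (i.1 j).1] `&` As k j @^-1` [set (i.1 j).2]))
   `&` Xs k s.+1 @^-1` [set i.2].
  case: i => h y; apply/seteqP; split=> w; rewrite /hist /=.
    by case=> <- <-; split=> // j _ /=; rewrite ffunE.
  case=> H ->; congr (_, _); apply/ffunP => j; rewrite ffunE.
  by have [/= -> ->] := H j I; case: (h j).
apply: measurableI => //; apply: fin_bigcap_measurable => [|j _]; first exact: finite_finset.
exact: measurableI.
Qed.

Lemma first_at_hist s h y : first_at s `&` [set w | hist s w = (h, y)] =
  if [forall j, h j != (x, a)]
  then B `&` cyl s.+1 (upd (hist_state h) s.+1 y) (upd (hist_action h) s a) else set0.
Proof.
rewrite /first_at fvisit_Some; apply/seteqP; split=> w /=; rewrite /hist /=.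
  move=> [[Bw [[Xx Aa] nv]] [hE yE]].
  case: ifPn => [_|/forallPn[j]]; last first.
    rewrite negbK -hE ffunE => /eqP[Xj Aj].
    by case: (nv j (ltn_ord j)); split.
  split=> //; split=> t ts; rewrite /upd /hist_state /hist_action.
    case: eqP => [-> //|/eqP ne]; case: insubP => [j _ <-|]; first by rewrite -hE ffunE.
    rewrite -leqNgt => st; have -> // : t = s by lia.
  split=> //; case: eqP => [-> //|/eqP ne]; case: insubP => [j _ <-|].
    by rewrite -hE ffunE.
  by rewrite -leqNgt => st; lia.
case: ifP => // /forallP ok [Bw [H1 H2]].
have Xj (j : 'I_s) : Xs k j w = (h j).1.
  have := H1 j; rewrite /upd /hist_state valK ltn_eqF; last by rewrite ltnS ltnW.
  by apply; rewrite ltnW // ltnS ltnW.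
have Aj (j : 'I_s) : As k j w = (h j).2.
  have := H2 j; rewrite /upd /hist_action valK ltn_eqF //.
  by move=> H; apply: (H _).1; rewrite ltnS ltnW.
split.
  split=> //; split.
    split; last by have [] := H2 s (leqnn _); rewrite /upd eqxx.
    have := H1 s (leqW (leqnn _)); rewrite /upd /hist_state ltn_eqF // insubF //.
    by rewrite ltnn.
  move=> t /= ts [Xt At]; have /negP := ok (Ordinal ts); apply; apply/eqP.
  by move: (Xj (Ordinal ts)) (Aj (Ordinal ts)); rewrite /= Xt At => -> ->; case: (h _).
congr (_, _); last by have := H1 s.+1 (leqnn _); rewrite /upd eqxx.
by apply/ffunP => j; rewrite ffunE Xj Aj; case: (h j).
Qed.

Let wt s (h : {ffun 'I_s -> X * Act}) : R :=
  if [forall j, h j != (x, a)]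
  then fine (Pr (B `&` cyl s (hist_state h) (hist_action h))) * p x a else 0.

Let Pr_first_hist s h y :
  Pr (first_at s `&` [set w | hist s w = (h, y)]) = (wt h * Pt x a y)%:E.
Proof.
rewrite first_at_hist /wt; case: ifP => _; last by rewrite measure0 mul0r.
rewrite Pr_cylS -[X in (_ * X)%E]fineK ?fin_num_measure //; last exact: measurable_Bcyl.
rewrite /hist_state insubF ?ltnn // -/(hist_state h).
by rewrite -EFinM; congr EFin; ring.
Qed.

(** The mass of a history and a next state factors as [wt h * Pt x a y]. The mean over the next
    state is therefore the same for every history, and summing over histories restores the mass of
    [first_at s]. *)
Lemma integral_first s t : (\int[Pr]_(w in first_at s) (Rs k (s + t) w)%:E =
  Pr (first_at s) * (action_reward t x a)%:E)%E.
Proof.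
rewrite (integral_partition _ (@hist_measurable s)) //; last exact: first_at_measurable.
rewrite (measure_partition Pr (@hist_measurable s) (first_at_measurable s)).
transitivity (\sum_(i : {ffun 'I_s -> X * Act} * X)
    (wt i.1 * (Pt x a i.2 * next_reward t x a i.2))%:E)%E.
  apply: eq_bigr => -[h y] _; rewrite /= mulrA EFinM -Pr_first_hist first_at_hist.
  case: ifP => _; last by rewrite integral_set0 measure0 mul0e.
  rewrite integral_reward_next; congr (_ * _%:E)%E.
  by rewrite /upd !eqxx ltn_eqF // /hist_state insubF // ltnn.
rewrite sumEFin; transitivity ((\sum_(h : {ffun 'I_s -> X * Act}) wt h)%:E * (action_reward t x a)%:E)%E.
  rewrite -EFinM mulr_suml; congr EFin.
  rewrite -(pair_bigA _ (fun h y => wt h * (Pt x a y * next_reward t x a y))) /=.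
  by apply: eq_bigr => h _; rewrite -mulr_sumr.
congr (_ * _)%E; transitivity (\sum_(i : {ffun 'I_s -> X * Act} * X) (wt i.1 * Pt x a i.2)%:E)%E.
  2: by apply: eq_bigr => -[h y] _; exact/esym/Pr_first_hist.
rewrite sumEFin -(pair_bigA _ (fun h y => wt h * Pt x a y)) /=; congr EFin.
by apply: eq_bigr => h _; rewrite -mulr_sumr (PtP aA).2 mulr1.
Qed.

Lemma integral_first_sq s t : (\int[Pr]_(w in first_at s) (Rs k (s + t) w ^+ 2)%:E <=
  second_moment%:E * Pr (first_at s))%E.
Proof.
rewrite (@integral_partition _ _ _ _ _ _ (@hist_measurable s) _ (fun w => Rs k (s + t) w ^+ 2)); last 2 first.
- exact: first_at_measurable.
- exact: measurable_funX.
rewrite (measure_partition Pr (@hist_measurable s) (first_at_measurable s)).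
rewrite ge0_sume_distrr; last by move=> *; exact: measure_ge0.
apply: lee_sum => -[h y] _; rewrite first_at_hist; case: ifP => _.
  exact: integral_reward_sq_next.
by rewrite integral_set0 measure0 mule0.
Qed.

Definition Bvisited : set Omega := B `&` [set w | visited x a k w].

Lemma BvisitedE : Bvisited = \bigcup_s first_at s.
Proof.
apply/seteqP; split=> w; rewrite /Bvisited /first_at /visited /=.
  by case E : (fvisit k x a w) => [s|] [Bw] // _; exists s.
by move=> [s _ [Bw /= ->]].
Qed.

Lemma trivIset_first_at : trivIset setT first_at.
Proof.
apply/trivIsetP => i j _ _ ij; apply/seteqP; split=> w // [[_ /= Ei] [_ /= Ej]].
by move: ij; move: Ej; rewrite Ei => -[->]; rewrite eqxx.
Qed.

Lemma Bvisited_measurable : measurable Bvisited.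
Proof. rewrite BvisitedE; apply: bigcupT_measurable; exact: first_at_measurable. Qed.

Lemma Pr_Bvisited : (Pr Bvisited = \sum_(s <oo) Pr (first_at s))%E.
Proof.
have Pr1 (A : set Omega) : measurable A -> (Pr A = \int[Pr]_(w in A) (1 : R)%:E)%E.
  by move=> mA; rewrite -[LHS]mul1e; apply/esym; exact: integral_cst.
rewrite Pr1; last exact: Bvisited_measurable.
rewrite BvisitedE ge0_integral_bigcup //; last 2 first.
- exact: first_at_measurable.
- exact: trivIset_first_at.
by apply: eq_eseriesr => s _; rewrite -Pr1 //; exact: first_at_measurable.
Qed.

Lemma vreward_off t w : ~ visited x a k w -> vreward k x a t w = 0.
Proof. by rewrite /visited /vreward; case: (fvisit k x a w). Qed.

Lemma integral_vreward_restrict (f : R -> R) t : f 0 = 0 ->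
  (\int[Pr]_(w in B) (f (vreward k x a t w))%:E =
   \int[Pr]_(w in Bvisited) (f (vreward k x a t w))%:E)%E.
Proof.
move=> f0; rewrite /Bvisited integral_mkcondr; apply: eq_integral => w _.
rewrite patchE; case: ifPn => // /negP; rewrite inE /= => nv.
by rewrite vreward_off // f0.
Qed.

Lemma vreward_first (f : R -> R) t s :
  (\int[Pr]_(w in first_at s) (f (vreward k x a t w))%:E =
   \int[Pr]_(w in first_at s) (f (Rs k (s + t) w))%:E)%E.
Proof.
by apply: eq_integral => w; rewrite inE /first_at /vreward => -[_ /= ->].
Qed.

Lemma vreward_measurable t : measurable_fun setT (vreward k x a t).
Proof.
by apply: (@adapted_measurable _ _ _ (past_gen k.+1)); [exact: past_gen_measurable|exact: past_vreward].
Qed.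

Lemma integral_vreward_sq t : (\int[Pr]_(w in B) (vreward k x a t w ^+ 2)%:E <=
  second_moment%:E * Pr Bvisited)%E.
Proof.
rewrite (@integral_vreward_restrict (fun r => r ^+ 2)) ?expr0n //.
rewrite BvisitedE ge0_integral_bigcup //; last 4 first.
- exact: first_at_measurable.
- apply/measurable_EFinP; apply: measurable_funTS; apply: measurable_funX.
  exact: vreward_measurable.
- by move=> w _; rewrite lee_fin sqr_ge0.
- exact: trivIset_first_at.
rewrite -BvisitedE Pr_Bvisited -nneseriesZl; last by move=> *; exact: measure_ge0.
apply: lee_nneseries => [s _ _|s _]; first by apply: integral_ge0 => w _; rewrite lee_fin sqr_ge0.
by rewrite (@vreward_first (fun r => r ^+ 2)); exact: integral_first_sq.
Qed.

(** The first-visit times cut the visited event into countably many disjoint pieces with the same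
    conditional mean; square integrability permits summing the signed integrals. *)
Lemma integral_vreward t : sq_integrable Pr (vreward k x a t) ->
  (\int[Pr]_(w in B) (vreward k x a t w)%:E = Pr Bvisited * (action_reward t x a)%:E)%E.
Proof.
move=> sv; rewrite (@integral_vreward_restrict id) // BvisitedE integral_bigcup; last 3 first.
- exact: trivIset_first_at.
- exact: first_at_measurable.
- rewrite -BvisitedE; apply: integrableS (sq_integrable_integrable sv) => //.
  exact: Bvisited_measurable.
rewrite -BvisitedE Pr_Bvisited muleC -nneseriesZl; last by move=> *; exact: measure_ge0.
apply: eq_eseriesr => s _.
by rewrite (@vreward_first id) integral_first muleC.
Qed.
End Visit.
End Episode.

(** * The policies of the algorithm and the slices on which they are fixed *)

Definition exploration (k : nat) (x : X) (w : Omega) : R :=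
  eps Aset (fun i t => Xs i t w) (fun i t => As i t w) theta k x.

Lemma explorationE k x w : exploration k x w = ((1 + (nstate k x w)%:R) `^ theta)^-1.
Proof. by rewrite /exploration /eps powRN. Qed.

Lemma powR_nstate_ge1 k x w : 1 <= (1 + (nstate k x w)%:R) `^ theta.
Proof.
have n1 : 1 <= 1 + (nstate k x w)%:R :> R by rewrite lerDl.
apply: (@le_trans _ _ (1 `^ theta)); first by rewrite powR1.
apply: ge0_ler_powR => //; rewrite ?nnegrE ?(ltW theta_gt0) //.
Qed.

Lemma exploration_ge0 k x w : 0 <= exploration k x w.
Proof. by rewrite explorationE invr_ge0 powR_ge0. Qed.

Lemma exploration_le1 k x w : exploration k x w <= 1.
Proof.
by rewrite explorationE invf_le1 ?powR_nstate_ge1 //.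
Qed.

Lemma pikE k x a w : pik w k x a = if a \in Aset x then
  exploration k x w / #|Aset x|%:R + (a \in greedy k x w)%:R * (1 - exploration k x w) / #|greedy k x w|%:R
  else 0.
Proof. by []. Qed.

Lemma greedy_sub k x w : greedy k x w \subset Aset x.
Proof. by apply/fintype.subsetP => a; rewrite inE => /andP[]. Qed.

Lemma greedy_gt0 k x w : (0 < #|greedy k x w|)%N.
Proof.
have /card_gt0P[a0 a0A] := Aset_gt0 x.
have [a aA aM] : exists2 a, a \in Aset x & forall b, b \in Aset x -> Qhat k x b w <= Qhat k x a w.
  exists [arg max_(i > a0 in Aset x) Qhat k x i w]%O; by case: arg_maxP.
apply/card_gt0P; exists a; rewrite inE aA; apply/forallP => b.
by apply/implyP => bA; exact: aM.
Qed.

Lemma pik_stochastic k w : stochastic Aset (pik w k).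
Proof.
move=> x; have e0 := exploration_ge0 k x w; have e1 := exploration_le1 k x w; split; last split.
- move=> a; rewrite pikE; case: ifP => // _.
  by rewrite addr_ge0 // ?divr_ge0 // mulr_ge0 // subr_ge0.
- by move=> a na; rewrite pikE (negbTE na).
- rewrite (eq_bigr (fun a => exploration k x w / #|Aset x|%:R +
    (a \in greedy k x w)%:R * ((1 - exploration k x w) / #|greedy k x w|%:R))); last first.
    by move=> a aA; rewrite pikE aA mulrA.
  rewrite big_split /= sumr_const -mulr_suml.
  have -> : \sum_(a in Aset x) (a \in greedy k x w)%:R = #|greedy k x w|%:R :> R.
    rewrite -natr_sum; congr _%:R; rewrite -sum1_card big_mkcond [RHS]big_mkcond /=.
    apply: eq_bigr => a _; case: ifPn => aA; case: ifPn => // ag.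
    by move/fintype.subsetP/(_ _ ag): (greedy_sub k x w); rewrite (negbTE aA).
  rewrite -[X in X + _]mulr_natr divfK ?pnatr_eq0 -?lt0n // mulrC divfK ?pnatr_eq0 -?lt0n ?greedy_gt0 //.
  by ring.
Qed.

Lemma code_measurable k c : measurable [set w | code k w = c].
Proof. by apply: (sub_sigma_measurable (@past_gen_measurable k)); exact: past_code. Qed.

Lemma past_code_slice k B c : <<s past_gen k >> B ->
  <<s past_gen k >> (B `&` [set w | code k w = c]).
Proof.
by move=> pB; apply: (@measurableI _ (past_type k)) => //; exact: past_code.
Qed.

Lemma code_slice_policy k B c w : (B `&` [set w | code k w = c]) w ->
  pik w k = code_policy c.
Proof. by move=> [_ /= <-]; rewrite code_policyE. Qed.

(** A code that no path realises may carry an empty greedy set and fail to define a policy; its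
    slice is then empty and contributes nothing. *)
Lemma code_slice_stochastic k B c : B `&` [set w | code k w = c] = set0 \/
  stochastic Aset (code_policy c).
Proof.
have [->|/set0P[w H]] := eqVneq (B `&` [set w | code k w = c]) set0; [by left|right].
by rewrite -(code_slice_policy H); exact: pik_stochastic.
Qed.

(** * Conditional mean and second moment of the first-visit return *)

Section Return.
Variables (k : nat) (x : X) (a : Act).
Hypothesis aA : a \in Aset x.

Local Notation visited_set := [set w | visited x a k w].
Local Notation rho t w := (vreward k x a t w).

Lemma visited_set_measurable : measurable visited_set.
Proof.
by apply: (sub_sigma_measurable (@past_gen_measurable k.+1)); exact: past_visited.
Qed.

Lemma past_measurable j B : <<s past_gen j >> B -> measurable B.
Proof. exact: (sub_sigma_measurable (@past_gen_measurable j)). Qed.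

Lemma integral_vreward_sq_past t B : <<s past_gen k >> B ->
  (\int[Pr]_(w in B) (rho t w ^+ 2)%:E <= second_moment%:E * Pr (B `&` visited_set))%E.
Proof.
move=> pB; have mB := past_measurable pB.
rewrite (@integral_partition _ _ _ _ _ _ (@code_measurable k) _ (fun w => rho t w ^+ 2)) //; last first.
  by apply: measurable_funX; exact: vreward_measurable.
rewrite (measure_partition Pr (@code_measurable k)); last first.
  by apply: measurableI => //; exact: visited_set_measurable.
rewrite ge0_sume_distrr; last by move=> *; exact: measure_ge0.
apply: lee_sum => c _; rewrite setIAC.
have [->|sc] := code_slice_stochastic B c.
  by rewrite integral_set0 set0I measure0 mule0.
exact: (integral_vreward_sq (past_code_slice c pB) (@code_slice_policy k B c) sc aA).
Qed.

Lemma vreward_sq_integrable t : sq_integrable Pr (vreward k x a t).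
Proof.
split; first exact: vreward_measurable.
have pT : <<s past_gen k >> setT by exact: (@measurableT _ (past_type k)).
apply: (le_lt_trans (integral_vreward_sq_past t pT)).
rewrite -[X in (_ * X)%E]fineK ?fin_num_measure //; first by rewrite -EFinM ltry.
by rewrite setTI; exact: visited_set_measurable.
Qed.

(** The weight is [gamma ^+ t] and not its square: by the Cauchy-Schwarz inequality with these
    weights, this variable divided by [1 - gamma] dominates all squared partial returns, while its
    integral is still finite. *)
Definition sq_total (w : Omega) : \bar R := (\sum_(t <oo) (gamma ^+ t * rho t w ^+ 2)%:E)%E.

Lemma sq_term_ge0 t w : (0 <= (gamma ^+ t * rho t w ^+ 2)%:E)%E.
Proof. by rewrite lee_fin mulr_ge0 ?sqr_ge0 ?exprn_ge0. Qed.

Lemma sq_term_measurable t : measurable_fun setT (fun w => (gamma ^+ t * rho t w ^+ 2)%:E).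
Proof.
apply/measurable_EFinP; apply: measurable_funM; first exact: measurable_cst.
by apply: measurable_funX; exact: vreward_measurable.
Qed.

Lemma sq_total_measurable : measurable_fun setT sq_total.
Proof.
apply: (ge0_emeasurable_sum (P := xpredT)) => // t *; [exact: sq_term_ge0|exact: sq_term_measurable].
Qed.

Lemma sq_total_ge0 w : (0 <= sq_total w)%E.
Proof. by apply: nneseries_ge0 => t _ _; exact: sq_term_ge0. Qed.

Lemma geometric_sum_le n : \sum_(0 <= t < n) gamma ^+ t <= (1 - gamma)^-1.
Proof.
have g1 : 0 < 1 - gamma by rewrite subr_gt0.
rewrite -[leRHS]mul1r ler_pdivlMr //.
have -> : (\sum_(0 <= t < n) gamma ^+ t) * (1 - gamma) = 1 - gamma ^+ n.
  elim: n => [|n IH]; first by rewrite big_geq // mul0r expr0 subrr.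
  by rewrite big_nat_recr //= mulrDl IH exprS; ring.
by rewrite gerBl exprn_ge0.
Qed.

Lemma integral_sq_total_le B : <<s past_gen k >> B ->
  (\int[Pr]_(w in B) sq_total w <=
   (second_moment / (1 - gamma))%:E * Pr (B `&` visited_set))%E.
Proof.
move=> pB; have mB := past_measurable pB.
have mV : measurable (B `&` visited_set) by apply: measurableI => //; exact: visited_set_measurable.
rewrite integral_nneseries //; last 2 first.
- by move=> t; apply: measurable_funTS; exact: sq_term_measurable.
- by move=> t w _; exact: sq_term_ge0.
apply: lime_le.
  apply: is_cvg_nneseries => t _ _; apply: integral_ge0 => w _; exact: sq_term_ge0.
apply: nearW => n.
apply: (@le_trans _ _ (\sum_(0 <= t < n) (gamma ^+ t)%:E * (second_moment%:E * Pr (B `&` visited_set)))%E).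
  apply: lee_sum => t _.
  under eq_integral do rewrite EFinM.
  rewrite ge0_integralZl_EFin ?exprn_ge0 //; last 2 first.
  - by move=> w _; rewrite lee_fin sqr_ge0.
  - apply/measurable_EFinP; apply: measurable_funTS; apply: measurable_funX.
    exact: vreward_measurable.
  by apply: lee_wpmul2l; rewrite ?lee_fin ?exprn_ge0 //; exact: integral_vreward_sq_past.
rewrite -[Pr _]fineK ?fin_num_measure // -!EFinM.
under eq_bigr do rewrite -EFinM.
rewrite sumEFin lee_fin -mulr_suml [leRHS]mulrAC mulrC ler_wpM2l //.
  by rewrite mulr_ge0 ?second_moment_ge0 ?fine_ge0.
exact: geometric_sum_le.
Qed.

Lemma disc_sum_sq_le n w : (\sum_(0 <= t < n) gamma ^+ t * rho t w) ^+ 2 <=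
  (\sum_(0 <= t < n) gamma ^+ t) * \sum_(0 <= t < n) gamma ^+ t * rho t w ^+ 2.
Proof.
elim: n => [|n IH]; first by rewrite !big_geq // expr0n mul0r.
rewrite !big_nat_recr //=; move: IH.
have S0 : 0 <= \sum_(0 <= t < n) gamma ^+ t by apply: sumr_ge0 => t _; exact: exprn_ge0.
have Q0 : 0 <= \sum_(0 <= t < n) gamma ^+ t * rho t w ^+ 2.
  by apply: sumr_ge0 => t _; rewrite mulr_ge0 ?sqr_ge0 ?exprn_ge0.
have g0 : 0 <= gamma ^+ n by exact: exprn_ge0.
move: (\sum_(0 <= t < n) gamma ^+ t * rho t w) => A; move: S0 Q0 g0.
move: (\sum_(0 <= t < n) _) (\sum_(0 <= t < n) _) (gamma ^+ n) (rho n w) => Q s g r.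
move=> s0 Q0 g0 IH.
(* After multiplication by the total weight [s] this follows from [(s * r - A) ^ 2 >= 0] and the
   induction hypothesis; if [s = 0], that hypothesis forces [A = 0]. *)
have key : 2 * A * r <= s * r ^+ 2 + Q.
  move: s0; rewrite le0r => /orP[/eqP sE|s0].
    have A0 : A = 0 by apply/eqP; rewrite -sqrf_eq0 eq_le sqr_ge0 andbT; move: IH; rewrite sE mul0r.
    by rewrite A0 sE !(mulr0, mul0r) add0r.
  rewrite -(ler_pM2l s0); have := sqr_ge0 (s * r - A); nra.
have := ler_wpM2l g0 key; nra.
Qed.

Lemma partial_sq_le n w : (((\sum_(0 <= t < n) gamma ^+ t * rho t w) ^+ 2)%:E <=
  (1 - gamma)^-1%:E * sq_total w)%E.
Proof.
apply: (@le_trans _ _ ((1 - gamma)^-1%:E * (\sum_(0 <= t < n) gamma ^+ t * rho t w ^+ 2)%:E)%E).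
  rewrite -EFinM lee_fin; apply: le_trans (disc_sum_sq_le n w) _.
  rewrite ler_wpM2r ?geometric_sum_le //.
  by apply: sumr_ge0 => t _; rewrite mulr_ge0 ?sqr_ge0 ?exprn_ge0.
apply: lee_wpmul2l; first by rewrite lee_fin invr_ge0 subr_ge0 ltW.
rewrite -sumEFin; apply: nneseries_lim_ge => t _ _; exact: sq_term_ge0.
Qed.

Lemma fvreturn_cvg w : (sq_total w < +oo)%E ->
  \sum_(0 <= t < n) gamma ^+ t * rho t w @[n --> \oo] --> fvreturn k x a w.
Proof.
move=> fin; rewrite fvreturnE.
apply: (@normed_cvg _ _ (fun t => gamma ^+ t * rho t w : R^o)).
apply: (@series_le_cvg _ _ (fun t => gamma ^+ t + gamma ^+ t * rho t w ^+ 2)).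
- by move=> n; exact: normr_ge0.
- by move=> n; apply: addr_ge0; [|apply: mulr_ge0; [|exact: sqr_ge0]]; exact: exprn_ge0.
- move=> n /=; rewrite normrM (ger0_norm (exprn_ge0 _ _)) //.
  rewrite -[X in _ <= X + _]mulr1 -mulrDr ler_wpM2l ?exprn_ge0 //.
  rewrite -[X in _ + X]real_normK ?num_real //.
  have := sqr_ge0 (`|rho n w| - 1); have := normr_ge0 (rho n w); nra.
have fS : sq_total w \is a fin_num by rewrite ge0_fin_numE // sq_total_ge0.
apply: nondecreasing_is_cvgn.
  apply/nondecreasing_seqP => n; rewrite /series /= big_nat_recr //= lerDl.
  by apply: addr_ge0; [|apply: mulr_ge0; [|exact: sqr_ge0]]; exact: exprn_ge0.
exists ((1 - gamma)^-1 + fine (sq_total w)) => _ [n _ <-].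
rewrite /series /= big_split /= lerD ?geometric_sum_le //.
rewrite -lee_fin fineK // -sumEFin; apply: nneseries_lim_ge => t _ _; exact: sq_term_ge0.
Qed.

Lemma fvreturn_sq_le w : ((fvreturn k x a w ^+ 2)%:E <= (1 - gamma)^-1%:E * sq_total w)%E.
Proof.
have g1 : 0 < (1 - gamma)^-1 by rewrite invr_gt0 subr_gt0.
(* Where [sq_total] is infinite the bound is void, whatever value [limn] takes there. *)
have [fin|] := ltP (sq_total w) +oo%E; last first.
  by rewrite leye_eq => /eqP ->; rewrite gt0_muley ?lte_fin // leey.
have fS : sq_total w \is a fin_num by rewrite ge0_fin_numE // sq_total_ge0.
have c := fvreturn_cvg fin.
have c2 : (\sum_(0 <= t < n) gamma ^+ t * rho t w) ^+ 2 @[n --> \oo] --> fvreturn k x a w ^+ 2.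
  by rewrite expr2; under eq_fun do rewrite expr2; exact: cvgM.
rewrite -(fineK fS) -EFinM lee_fin -(cvg_lim _ c2) //; apply: limr_le.
  by apply/cvg_ex; eexists; exact: c2.
by apply: nearW => n; rewrite -lee_fin [X in (_ <= X)%E]EFinM (fineK fS); exact: partial_sq_le.
Qed.

Lemma fvreturn_measurable : measurable_fun setT (fvreturn k x a).
Proof.
by apply: (@adapted_measurable _ _ _ (past_gen k.+1)); [exact: past_gen_measurable|exact: past_fvreturn].
Qed.

Lemma integral_fvreturn_sq_le B : <<s past_gen k >> B ->
  (\int[Pr]_(w in B) (fvreturn k x a w ^+ 2)%:E <=
   (second_moment / (1 - gamma) ^+ 2)%:E * Pr (B `&` visited_set))%E.
Proof.
move=> pB; have mB := past_measurable pB.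
have g1 : 0 <= (1 - gamma)^-1 by rewrite invr_ge0 subr_ge0 ltW.
apply: (@le_trans _ _ (\int[Pr]_(w in B) ((1 - gamma)^-1%:E * sq_total w))%E).
  apply: ge0_le_integral => //.
  - by move=> w _; rewrite lee_fin sqr_ge0.
  - apply/measurable_EFinP; apply: measurable_funTS; apply: measurable_funX.
    exact: fvreturn_measurable.
  - by apply: measurable_funeM; apply: measurable_funTS; exact: sq_total_measurable.
  - by move=> w _; exact: fvreturn_sq_le.
rewrite ge0_integralZl_EFin //; last 2 first.
- by move=> w _; exact: sq_total_ge0.
- by apply: measurable_funTS; exact: sq_total_measurable.
apply: (@le_trans _ _ ((1 - gamma)^-1%:E *
   ((second_moment / (1 - gamma))%:E * Pr (B `&` visited_set)))%E).
  by apply: lee_wpmul2l; [rewrite lee_fin|exact: integral_sq_total_le].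
rewrite muleA -EFinM le_eqVlt; apply/orP; left; apply/eqP; congr (_%:E * _)%E.
by rewrite expr2 invfM; ring.
Qed.

Lemma fvreturn_sq_integrable : sq_integrable Pr (fvreturn k x a).
Proof.
split; first exact: fvreturn_measurable.
have pT : <<s past_gen k >> setT by exact: (@measurableT _ (past_type k)).
apply: (le_lt_trans (integral_fvreturn_sq_le pT)).
rewrite -[X in (_ * X)%E]fineK ?fin_num_measure //; first by rewrite -EFinM ltry.
by rewrite setTI; exact: visited_set_measurable.
Qed.

Lemma disc_action_reward p n : \sum_(0 <= t < n.+1) gamma ^+ t * action_reward p t x a =
  \sum_y Pt x a y * (mean_reward S x a y +
     gamma * trunc_value Aset Pt S gamma (sm_policy p) n [::] y).
Proof.
rewrite big_nat_recl // expr0 mul1r /trunc_value.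
under [X in _ + X]eq_bigr => t _ do rewrite /action_reward mulr_sumr.
rewrite exchange_big /= -big_split /=; apply: eq_bigr => y _.
rewrite mulrDr !mulr_sumr; congr (_ + _); apply: eq_bigr => t _; rewrite exprS; ring.
Qed.

Lemma disc_action_reward_cvg p : stochastic Aset p ->
  \sum_(0 <= t < n) gamma ^+ t * action_reward p t x a @[n --> \oo] -->
  lookahead Pt S gamma (value Aset Pt S gamma (sm_policy p)) x a.
Proof.
move=> sp; rewrite -(cvg_shiftS _) /=.
rewrite (_ : (fun n => _) = fun n => \sum_y Pt x a y * (mean_reward S x a y +
     gamma * trunc_value Aset Pt S gamma (sm_policy p) n [::] y)); last first.
  by apply/funext => n; exact: disc_action_reward.
apply: cvg_sumr => y _; apply: cvgMr; apply: cvgD; first exact: cvg_cst.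
by apply: cvgMr; exact: trunc_value_to.
Qed.

Lemma sq_total_integrable : Pr.-integrable setT sq_total.
Proof.
apply/integrableP; split; first exact: sq_total_measurable.
under eq_integral do rewrite gee0_abs ?sq_total_ge0 //.
have pT : <<s past_gen k >> setT by exact: (@measurableT _ (past_type k)).
apply: (le_lt_trans (integral_sq_total_le pT)).
rewrite -[X in (_ * X)%E]fineK ?fin_num_measure //; first by rewrite -EFinM ltry.
by rewrite setTI; exact: visited_set_measurable.
Qed.

Lemma partial_measurable n :
  measurable_fun setT (fun w => \sum_(0 <= t < n) gamma ^+ t * rho t w).
Proof.
apply: measurable_sum => t; apply: measurable_funM; first exact: measurable_cst.
exact: vreward_measurable.
Qed.

(** The mean is known term by term. Dominated convergence sums the series, the dominating variable
    coming from [|s| <= 1 + s ^ 2] and the bound on squared partial returns. *)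
Lemma integral_fvreturn_slice p B : <<s past_gen k >> B ->
  (forall w, B w -> pik w k = p) -> stochastic Aset p ->
  (\int[Pr]_(w in B) (fvreturn k x a w)%:E = Pr (B `&` visited_set) *
   (lookahead Pt S gamma (value Aset Pt S gamma (sm_policy p)) x a)%:E)%E.
Proof.
move=> pB Bp sp; have mB := past_measurable pB.
have mV : measurable (B `&` visited_set) by apply: measurableI => //; exact: visited_set_measurable.
have g1 : 0 <= (1 - gamma)^-1 by rewrite invr_ge0 subr_ge0 ltW.
have iS : Pr.-integrable B sq_total by exact: integrableS sq_total_integrable.
have := @dominated_convergence _ Omega R Pr B mB
  (fun n w => (\sum_(0 <= t < n) gamma ^+ t * rho t w)%:E) (fun w => (fvreturn k x a w)%:E)
  (fun w => 1%:E + (1 - gamma)^-1%:E * sq_total w)%E.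
case.
- by move=> n; apply/measurable_EFinP; apply: measurable_funTS; exact: partial_measurable.
- by apply/measurable_EFinP; apply: measurable_funTS; exact: fvreturn_measurable.
- have := integrable_ae measurableT sq_total_integrable; apply: filterS => w /(_ I) fw _.
  apply/cvg_EFin; first exact: nearW.
  by apply: fvreturn_cvg; move: fw; rewrite fin_numElt => /andP[].
- apply: integrableD => //; last exact: integrableZl.
  exact: finite_measure_integrable_cst.
- apply: aeW => w n _; have := partial_sq_le n w.
  have [fw|] := ltP (sq_total w) +oo%E; last first.
    rewrite leye_eq => /eqP ->; rewrite gt0_muley ?lte_fin ?invr_gt0 ?subr_gt0 //.
    by move=> _; rewrite addey // leey.
  have fS : sq_total w \is a fin_num by rewrite ge0_fin_numE // sq_total_ge0.
  rewrite abse_EFin -(fineK fS) -EFinM -EFinD !lee_fin; move: (\sum_(0 <= t < n) _) => s ss.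
  apply: le_trans (_ : 1 + s ^+ 2 <= _); last by rewrite lerD2l.
  rewrite -[X in _ + X]real_normK ?num_real //.
  have := sqr_ge0 (`|s| - 1); have := normr_ge0 s; nra.
move=> _ _; have -> : (fun n => (\int[Pr]_(w in B) (\sum_(0 <= t < n) gamma ^+ t * rho t w)%:E)%E) =
   (fun n => (Pr (B `&` visited_set) * (\sum_(0 <= t < n) gamma ^+ t * action_reward p t x a)%:E)%E).
  apply/funext => n.
  transitivity (\int[Pr]_(w in B) (\sum_(0 <= t < n) (gamma ^+ t)%:E * (rho t w)%:E))%E.
    by apply: eq_integral => w _; rewrite -sumEFin.
  have iv t : Pr.-integrable B (fun w => (rho t w)%:E).
    exact: integrableS (sq_integrable_integrable (vreward_sq_integrable t)).
  rewrite integral_sum //; last by move=> t; exact: integrableZl.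
  rewrite -[Pr _]fineK ?fin_num_measure // -EFinM mulr_sumr -sumEFin.
  apply: eq_bigr => t _; rewrite integralZl //.
  rewrite (integral_vreward pB Bp sp aA (vreward_sq_integrable t)).
  by rewrite -[Pr _]fineK ?fin_num_measure // -!EFinM; congr EFin; ring.
move=> /cvg_lim <- //; apply/cvg_lim => //.
rewrite -[Pr _]fineK ?fin_num_measure //; under eq_fun do rewrite -EFinM.
rewrite -EFinM; apply/cvg_EFin; first exact: nearW.
by apply: cvgMr; exact: disc_action_reward_cvg.
Qed.
End Return.

Definition action_value i x a w : R :=
  lookahead Pt S gamma (value Aset Pt S gamma (sm_policy (pik w i))) x a.

(** The action value is known before episode [i] and is subtracted only on a visit: a martingale
    difference supported on visits. *)
Definition deviation x a i w : R :=
  fvreturn i x a w - (visited x a i w)%:R * action_value i x a w.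

Lemma past_action_value i x a : adapted (past_gen i) (action_value i x a).
Proof.
have -> : action_value i x a = fun w => lookahead Pt S gamma
    (value Aset Pt S gamma (sm_policy (code_policy (code i w)))) x a.
  by apply/funext => w; rewrite code_policyE.
apply: (@measurable_fun_case _ _ (past_type i) _ (code i)
  (fun c _ => lookahead Pt S gamma (value Aset Pt S gamma (sm_policy (code_policy c))) x a)).
- by move=> c; exact: past_code.
- by move=> c; exact: measurable_cst.
Qed.

Lemma past_visited_nat i x a : adapted (past_gen i.+1) (fun w => (visited x a i w)%:R : R).
Proof.
apply: (@measurable_fun_case _ _ (past_type i.+1) _ (fvisit i x a)
  (fun o _ => (o != None)%:R)).
- by move=> o; exact: past_fvisit.
- by move=> o; exact: measurable_cst.
Qed.

Lemma past_deviation i x a : adapted (past_gen i.+1) (deviation x a i).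
Proof.
apply: measurable_funB; first exact: past_fvreturn.
apply: measurable_funM; first exact: past_visited_nat.
by have := @past_action_value i x a; apply: adapted_mono; exact: past_gen_mono.
Qed.

Lemma deviation_off i x a w : ~~ visited x a i w -> deviation x a i w = 0.
Proof.
move=> nv; rewrite /deviation (negbTE nv) mul0r subr0.
move: nv; rewrite negbK => /eqP; rewrite /fvisit /fvreturn /first_visit_return => -> //.
Qed.

Definition value_scale : R := reward_bound S + gamma * value_bound Aset Pt S gamma.

Lemma action_value_bound i x a w : a \in Aset x -> `|action_value i x a w| <= value_scale.
Proof. by move=> aA; apply: lookahead_bound => //; exact: pik_stochastic. Qed.

Lemma integral_deviation i x a B : a \in Aset x -> <<s past_gen i >> B ->
  (\int[Pr]_(w in B) (deviation x a i w)%:E = 0)%E.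
Proof.
move=> aA pB; have mB := past_measurable pB.
have mV := visited_set_measurable i x a.
have mD : measurable_fun setT (deviation x a i).
  apply: (@adapted_measurable _ _ _ (past_gen i.+1)); first exact: past_gen_measurable.
  exact: past_deviation.
rewrite (integral_partition _ (@code_measurable i)) //; apply: big1 => c _.
have [->|sc] := code_slice_stochastic B c; first by rewrite integral_set0.
set Bc := B `&` _; have pBc : <<s past_gen i >> Bc by exact: past_code_slice.
have mBc := past_measurable pBc.
set L := lookahead Pt S gamma (value Aset Pt S gamma (sm_policy (code_policy c))) x a.
transitivity (\int[Pr]_(w in Bc) ((fvreturn i x a w)%:E -
   L%:E * (\1_[set w | visited x a i w] w)%:E))%E.
  apply: eq_integral => w; rewrite inE => Bcw.
  rewrite -EFinM -EFinB /deviation /action_value (code_slice_policy Bcw) -/L mulrC indicE.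
  by rewrite (_ : (w \in _) = visited x a i w) //; apply/idP/idP; rewrite inE.
have iG : Pr.-integrable Bc (fun w => (fvreturn i x a w)%:E).
  exact: integrableS (sq_integrable_integrable (fvreturn_sq_integrable i aA)).
have iV : Pr.-integrable Bc (fun w => (\1_[set w | visited x a i w] w)%:E).
  apply: (@integrableS _ _ _ _ setT) => //.
  apply: (sq_integrable_integrable (f := \1_[set w | visited x a i w])).
  apply: (@sq_integrable_bounded _ _ _ _ _ 1); first exact: measurable_indic.
  by move=> w; rewrite indicE; case: (_ \in _); rewrite ?normr1 ?normr0.
rewrite integralB //; last exact: integrableZl.
rewrite integralZl // integral_indic // (integral_fvreturn_slice aA pBc (@code_slice_policy i B c) sc).
rewrite -/L setIC muleC subee // fin_numM // fin_num_measure //.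
by apply: measurableI.
Qed.

(** Comes from [(G - q) ^ 2 <= 2 * G ^ 2 + 2 * q ^ 2] on a visit, with [G] the return and [q] the
    action value, bounded by [value_scale]. *)
Definition deviation_var : R := 2 * (second_moment / (1 - gamma) ^+ 2) + 2 * value_scale ^+ 2.

Lemma deviation_var_ge0 : 0 <= deviation_var.
Proof.
rewrite addr_ge0 // mulr_ge0 ?sqr_ge0 // divr_ge0 ?second_moment_ge0 ?sqr_ge0 //.
Qed.

Lemma integral_deviation_sq i x a B : a \in Aset x -> <<s past_gen i >> B ->
  (\int[Pr]_(w in B) (deviation x a i w ^+ 2)%:E <=
   deviation_var%:E * Pr (B `&` [set w | visited x a i w]))%E.
Proof.
move=> aA pB; have mB := past_measurable pB.
have mV := visited_set_measurable i x a.
have mG := fvreturn_measurable i x a.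
have mI : measurable_fun setT (\1_[set w | visited x a i w] : Omega -> R) by exact: measurable_indic.
apply: (@le_trans _ _ (\int[Pr]_(w in B) (2%:E * (fvreturn i x a w ^+ 2)%:E +
   (2 * value_scale ^+ 2)%:E * (\1_[set w | visited x a i w] w)%:E))%E).
  apply: ge0_le_integral => //.
  - by move=> w _; rewrite lee_fin sqr_ge0.
  - apply/measurable_EFinP; apply: measurable_funTS; apply: measurable_funX.
    apply: (@adapted_measurable _ _ _ (past_gen i.+1)); first exact: past_gen_measurable.
    exact: past_deviation.
  - apply: measurable_funTS; apply: emeasurable_funD; apply: measurable_funeM; apply/measurable_EFinP => //.
    exact: measurable_funX.
  - move=> w _; rewrite -!EFinM -EFinD lee_fin /deviation indicE.
    rewrite (_ : (w \in _) = visited x a i w); last by apply/idP/idP; rewrite inE.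
    have := action_value_bound i w aA; move: (fvreturn _ _ _ _) (action_value _ _ _ _) => G q qb.
    have q2 : q ^+ 2 <= value_scale ^+ 2.
      by rewrite -[leLHS]real_normK ?num_real // lerXn2r ?nnegrE // (le_trans _ qb).
    case: (visited _ _ _ _); rewrite ?mul1r ?mul0r ?mulr1 ?mulr0.
      have := sqr_ge0 (G + q); lra.
    by rewrite subr0 addr0; have := sqr_ge0 G; lra.
rewrite ge0_integralD //; last 4 first.
- by move=> w _; rewrite -EFinM lee_fin mulr_ge0 ?sqr_ge0.
- apply: measurable_funTS; apply: measurable_funeM; apply/measurable_EFinP; exact: measurable_funX.
- by move=> w _; apply: mule_ge0; [rewrite lee_fin mulr_ge0 ?sqr_ge0|rewrite lee_fin indicE].
- by apply: measurable_funTS; apply: measurable_funeM; apply/measurable_EFinP.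
rewrite ge0_integralZl_EFin //; last 2 first.
- by move=> w _; rewrite lee_fin sqr_ge0.
- apply: measurable_funTS; apply/measurable_EFinP; exact: measurable_funX.
have v0 : 0 <= 2 * value_scale ^+ 2 by rewrite mulr_ge0 ?sqr_ge0.
rewrite ge0_integralZl_EFin //; last first.
  by apply: measurable_funTS; apply/measurable_EFinP.
rewrite integral_indic // [_ `&` B]setIC.
have mBV : measurable (B `&` [set w | visited x a i w]) by exact: measurableI.
have -> (r : \bar R) : r \is a fin_num -> (deviation_var%:E * r =
    (2 * (second_moment / (1 - gamma) ^+ 2))%:E * r + (2 * value_scale ^+ 2)%:E * r)%E.
  by move=> /fineK <-; rewrite -!EFinM -EFinD /deviation_var mulrDl.
2: exact: fin_num_measure.
apply: leeD => //; rewrite EFinM -muleA; apply: lee_wpmul2l; rewrite ?lee_fin //.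
exact: integral_fvreturn_sq_le.
Qed.

Lemma ae_deviation_average x a : a \in Aset x -> {ae Pr, forall w,
  (forall M, \forall k \near \oo, (M <= nvisits (visited x a) k w)%N) ->
  (\sum_(i < k) deviation x a i w) / (nvisits (visited x a) k w)%:R @[k --> \oo] --> 0}.
Proof.
move=> aA; apply: (@martingale_LLN _ _ _ _ past_gen _ _ _ _ deviation_var).
- exact: past_gen_measurable.
- exact: past_gen_mono.
- exact: deviation_var_ge0.
- by move=> i; exact: past_deviation.
- by move=> i; exact: past_visited.
- by move=> i w; exact: deviation_off.
- by move=> i B; exact: integral_deviation.
- by move=> i B; exact: integral_deviation_sq.
Qed.

(** * Recurrence of all admissible pairs *)

Hypotheses (theta_le1 : theta <= 1) (mu0_gt0 : forall x, 0 < mu0 x).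

Definition explore_rate (x : X) : R := mu0 x / (#|Act| ^ 2)%:R.

Lemma Act_gt0 (x : X) : (0 < #|Act|)%N.
Proof. by apply: leq_trans (Aset_gt0 x) _; exact: max_card. Qed.

Lemma explore_rate_gt0 x : 0 < explore_rate x.
Proof. by rewrite divr_gt0 // ltr0n expn_gt0 (Act_gt0 x). Qed.

(** As [theta <= 1], the exploration probability is at least [1 / (1 + nstate)], and
    [1 + nstate <= #|Act| * (k + 1)]; sharing it among at most [#|Act|] actions gives the second
    factor [#|Act|]. *)
Lemma pik_ge k w x a : a \in Aset x -> ((#|Act| ^ 2 * k.+1)%:R)^-1 <= pik w k x a.
Proof.
move=> aA; rewrite pikE aA; have A0 := Act_gt0 x.
apply: (@le_trans _ _ (exploration k x w / #|Aset x|%:R)); last first.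
  by rewrite lerDl !mulr_ge0 // ?invr_ge0 // subr_ge0 exploration_le1.
have n1 : 1 <= 1 + (nstate k x w)%:R :> R by rewrite lerDl.
rewrite explorationE -invfM lef_pV2 ?posrE ?mulr_gt0 ?ltr0n ?Aset_gt0 ?muln_gt0 ?expn_gt0 ?A0 //.
have -> : (#|Act| ^ 2 * k.+1)%:R = (#|Act| * k.+1)%:R * #|Act|%:R :> R.
  by rewrite -natrM; congr _%:R; lia.
rewrite ler_pM // ?powR_ge0 ?ler_nat ?max_card //.
apply: (@le_trans _ _ ((1 + (nstate k x w)%:R) `^ 1)); first exact: ler_powR.
rewrite powRr1 ?(le_trans _ n1) // nat1r ler_nat.
by apply: leq_ltn_trans (nstate_le k x w) _; rewrite mulnC; nia.
Qed.

Lemma Pr_start_ge k B x a : a \in Aset x -> <<s past_gen k >> B ->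
  ((explore_rate x / k.+1%:R)%:E * Pr B <= Pr (B `&` [set w | visited x a k w]))%E.
Proof.
move=> aA pB; have mB := past_measurable pB; have mV := visited_set_measurable k x a.
rewrite (measure_partition Pr (@code_measurable k)) //.
rewrite [leRHS](measure_partition Pr (@code_measurable k)); last exact: measurableI.
rewrite ge0_sume_distrr; last by move=> *; exact: measure_ge0.
apply: lee_sum => c _.
have [-> //|/set0P[w Hw]] := eqVneq (B `&` [set w | code k w = c]) set0.
  rewrite measure0 mule0; exact: measure_ge0.
have sc : stochastic Aset (code_policy c) by rewrite -(code_slice_policy Hw); exact: pik_stochastic.
have pge : ((#|Act| ^ 2 * k.+1)%:R)^-1 <= code_policy c x a.
  by rewrite -(code_slice_policy Hw); exact: pik_ge.
rewrite setIAC; set Bc := B `&` [set w | code k w = c].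
have pBc : <<s past_gen k >> Bc by exact: past_code_slice.
have mBc := past_measurable pBc.
have Bcp := @code_slice_policy k B c.
(* Length 1 is the shortest cylinder that fixes the action at time 0; it also fixes the next state,
   hence the sum over [y]. *)
pose cyl y : set Omega := cyl_event Xs As Rs k 1 (upd (fun=> x) 1 y) (upd (fun=> a) 0 a) (fun=> setT).
have cylP y : (Pr (Bc `&` cyl y) = (mu0 x * code_policy c x a * Pt x a y)%:E * Pr Bc)%E.
  rewrite /cyl (Pr_cylS pBc Bcp) (Pr_cyl_event pBc Bcp) // /path_weight big_ord0 muleA -EFinM.
  by congr (_%:E * _)%E; ring.
have mX1 y : measurable [set w | Xs k 1 w = y] by exact: mXs.
have mBV : measurable (Bc `&` [set w | visited x a k w]) by exact: measurableI.
rewrite [leRHS](measure_partition Pr mX1) //.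
apply: (@le_trans _ _ (\sum_y Pr (Bc `&` cyl y))); last first.
  apply: lee_sum => y _; apply: le_measure; rewrite ?inE.
  - by apply: measurableI => //; exact: cyl_event_measurable.
  - exact: measurableI.
  move=> w' [Bw [H1 H2]]; split; last by have := H1 1%N (leqnn _); rewrite /upd eqxx.
  split=> //=; rewrite /visited; apply/negP => /eqP H.
  have : [set w | fvisit k x a w = None] w' by [].
  rewrite fvisit_None => /(_ 0%N I); apply; split.
    by have := H1 0%N (leq0n _).
  by have [] := H2 0%N (leqnn _).
under eq_bigr do rewrite cylP.
rewrite -[Pr Bc]fineK ?fin_num_measure //; under eq_bigr do rewrite -EFinM.
rewrite -[X in (_ * X <= _)%E]fineK ?fin_num_measure //.
rewrite sumEFin -mulr_suml -mulr_sumr (PtP aA).2 mulr1 -EFinM lee_fin ler_wpM2r ?fine_ge0 //.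
rewrite /explore_rate -mulrA ler_wpM2l ?(ltW (mu0_gt0 x)) //.
by rewrite -invfM -natrM.
Qed.

Definition unvisited x a m n : set Omega :=
  [set w | forall i, (m <= i < n)%N -> ~~ visited x a i w].

Lemma past_unvisited x a m n : <<s past_gen n >> (unvisited x a m n).
Proof.
have -> : unvisited x a m n =
    \bigcap_(i in [set i | (m <= i < n)%N]) ~` [set w | visited x a i w].
  by apply/seteqP; split=> w H i /H /negP.
apply: (@bigcap_measurableType _ (past_type n)) => i /andP[_ lt_in].
by apply: sigma_algebraC; exact: past_visited.
Qed.

(** A conditional Borel-Cantelli bound without products or exponentials: with [z] the new term and
    [s] the sum so far, [(1 - z) * (1 + s + z) <= 1 + s]. *)
Lemma Pr_unvisited_le x a m n : a \in Aset x -> (m <= n)%N ->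
  fine (Pr (unvisited x a m n)) * (1 + explore_rate x * \sum_(m <= i < n) i.+1%:R^-1) <= 1.
Proof.
have Pr_le1 j : fine (Pr (unvisited x a m j)) <= 1.
  have mU := past_measurable (@past_unvisited x a m j).
  by rewrite -lee_fin fineK ?fin_num_measure ?probability_le1.
move=> aA; elim: n => [|n IH] mn.
  by rewrite big_geq // mulr0 addr0 mulr1; exact: Pr_le1.
move: mn; rewrite leq_eqVlt => /orP[/eqP <-|mn].
  by rewrite big_geq // mulr0 addr0 mulr1; exact: Pr_le1.
have {}IH := IH mn; rewrite big_nat_recr //= [explore_rate x * _]mulrDr [1 + _]addrA.
have mU := past_measurable (@past_unvisited x a m n).
have mV := visited_set_measurable n x a.
have step : fine (Pr (unvisited x a m n.+1)) <=
    fine (Pr (unvisited x a m n)) * (1 - explore_rate x / n.+1%:R).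
  have -> : unvisited x a m n.+1 = unvisited x a m n `\` [set w | visited x a n w].
    apply/seteqP; split=> w.
      move=> H; split; last by apply/negP; apply: H; rewrite ltnSn andbT.
      by move=> i /andP[mi lt_in]; apply: H; rewrite mi ltnW.
    move=> [H nv] i /andP[mi]; rewrite ltnS leq_eqVlt => /orP[/eqP ->|lt_in]; first exact/negP.
    by apply: H; rewrite mi.
  rewrite measureD //; last by rewrite -ge0_fin_numE ?measure_ge0 // fin_num_measure.
  have mI : measurable (unvisited x a m n `&` [set w | visited x a n w]) by exact: measurableI.
  have H : explore_rate x / n.+1%:R * fine (Pr (unvisited x a m n)) <=
      fine (Pr (unvisited x a m n `&` [set w | visited x a n w])).
    by rewrite -lee_fin EFinM !fineK ?fin_num_measure //; exact: Pr_start_ge (@past_unvisited x a m n).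
  rewrite fineB ?fin_num_measure // mulrBr mulr1 [X in _ <= _ - X]mulrC.
  by rewrite lerD2l lerN2.
have P1 : 0 <= fine (Pr (unvisited x a m n)) by rewrite fine_ge0.
have r0 := explore_rate_gt0 x.
have z0 : 0 <= explore_rate x / n.+1%:R by rewrite divr_ge0 // ltW.
have s0 : 0 <= explore_rate x * \sum_(m <= i < n) i.+1%:R^-1.
  by rewrite mulr_ge0 ?(ltW r0) // sumr_ge0.
have alg (p q z s : R) : p <= q * (1 - z) -> 0 <= q -> 0 <= z -> 0 <= s ->
    q * (1 + s) <= 1 -> p * (1 + s + z) <= 1.
  move=> pq q_ge0 z_ge0 s_ge0.
  have : p * (1 + s + z) <= q * (1 - z) * (1 + s + z) by rewrite ler_wpM2r // !addr_ge0.
  have : q * ((1 - z) * (1 + s + z)) <= q * (1 + s) by rewrite ler_wpM2l //; nra.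
  by rewrite mulrA; lra.
exact: alg step P1 z0 s0 IH.
Qed.

(** Paths that miss the pair from some episode on lie in a countable union of events [U m]; if one
    of these had positive probability, the harmonic series would be bounded. *)
Lemma ae_visited_infinitely_often x a : a \in Aset x -> {ae Pr, forall w,
  forall M, \forall k \near \oo, (M <= nvisits (visited x a) k w)%N}.
Proof.
move=> aA; pose U m := \bigcap_n unvisited x a m n.
have mU m : measurable (U m).
  by apply: bigcap_measurableType => n _; exact: past_measurable (@past_unvisited _ _ _ _).
have U0 m : Pr (U m) = 0%E.
  apply/eqP; rewrite eq_le measure_ge0 andbT leNgt; apply/negP => Ugt0.
  have UF : Pr (U m) \is a fin_num by exact: fin_num_measure.
  have u0 : 0 < fine (Pr (U m)) by rewrite -lte_fin fineK.
  have bnd n : (m <= n)%N -> \sum_(m <= i < n) i.+1%:R^-1 <=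
      (fine (Pr (U m)) * explore_rate x)^-1 :> R.
    move=> mn; have r0 := explore_rate_gt0 x.
    have pr0 : 0 < fine (Pr (U m)) * explore_rate x by exact: mulr_gt0.
    rewrite -[leRHS]mul1r ler_pdivlMr //; apply: le_trans (Pr_unvisited_le aA mn).
    have mUn := past_measurable (@past_unvisited x a m n).
    have le_U : fine (Pr (U m)) <= fine (Pr (unvisited x a m n)).
      rewrite fine_le ?fin_num_measure //; apply: le_measure; rewrite ?inE //.
      by move=> w /(_ n I).
    have s0 : 0 <= \sum_(m <= i < n) i.+1%:R^-1 :> R by exact: sumr_ge0.
    have : fine (Pr (U m)) * (1 + explore_rate x * \sum_(m <= i < n) i.+1%:R^-1) <=
      fine (Pr (unvisited x a m n)) * (1 + explore_rate x * \sum_(m <= i < n) i.+1%:R^-1).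
      by rewrite ler_wpM2r // addr_ge0 // mulr_ge0 // ltW.
    apply: le_trans; rewrite mulrDr mulr1.
    have -> (p r s : R) : s * (p * r) = p * (r * s) by ring.
    by rewrite lerDr ltW.
  apply: (@dvg_harmonic R); apply: nondecreasing_is_cvgn.
    by apply/nondecreasing_seqP => n; rewrite /series /= big_nat_recr //= lerDl.
  exists (\sum_(0 <= i < m) i.+1%:R^-1 + (fine (Pr (U m)) * explore_rate x)^-1) => _ [n _ <-].
  rewrite /series /=; have [mn|nm] := leqP m n.
    by rewrite (big_cat_nat (n := m)) //= lerD2l bnd.
  rewrite (big_cat_nat (n := n) (p := m)) //=; last exact: ltnW.
  rewrite -addrA lerDl addr_ge0 ?sumr_ge0 // invr_ge0 mulr_ge0 ?(ltW u0) //.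
  exact: ltW (explore_rate_gt0 x).
have : Pr.-negligible (\bigcup_m U m).
  apply: negligible_bigcup => m; apply/negligibleP => //; exact: U0.
apply: negligibleS => w /=; apply: contra_notP => notU M.
have inf m : exists2 i, (m <= i)%N & visited x a i w.
  apply: contra_notP notU => ne; exists m => // n _ i /andP[mi _].
  by apply/negP => vi; apply: ne; exists i.
elim: M => [|M [K _ HK]]; first exact: nearW.
have [i Ki vi] := inf K; exists i.+1 => // k /= ik.
apply: leq_trans (nvisits_le (visited x a) w ik).
by rewrite /nvisits big_ord_recr /= vi addn1 ltnS; exact: HK.
Qed.

(** * The deterministic hypotheses along almost every path *)

Lemma exploration_cvg0 x w :
  (forall M, \forall k \near \oo, (M <= nstate k x w)%N) -> exploration k x w @[k --> \oo] --> 0.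
Proof.
(* [b] solves [b ^ theta = 1 / e]: once the counter [nstate] exceeds it, the exploration is at most
   [e]. *)
move=> Ninf; apply/cvgr0Pnorm_le => e e0; pose b := e^-1 `^ theta^-1.
have b0 : 0 <= b by exact: powR_ge0.
apply: filterS (Ninf (Num.bound b)) => k bk.
rewrite ger0_norm ?exploration_ge0 // explorationE -[leRHS]invrK.
have eE : e^-1 = b `^ theta.
  by rewrite /b -powRrM mulVf ?gt_eqF // powRr1 // invr_ge0 ltW.
rewrite lef_pV2 ?posrE ?invr_gt0 // ?eE.
  apply: ge0_ler_powR; rewrite ?nnegrE ?addr_ge0 ?(ltW theta_gt0) //.
  apply: (@le_trans _ _ (nstate k x w)%:R); last by rewrite lerDr.
  by apply: le_trans (ltW (archi_boundP b0)) _; rewrite ler_nat.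
Qed.

Lemma pik_greedy k w x a c : a \in Aset x -> c \in Aset x ->
  Qhat k x a w < Qhat k x c w -> pik w k x a <= exploration k x w.
Proof.
move=> aA cA lt_ac; rewrite pikE aA.
have /negbTE -> : a \notin greedy k x w.
  rewrite inE aA /=; apply/forallPn; exists c.
  by rewrite cA /= -ltNge.
rewrite !mul0r addr0 ler_pdivrMr ?ltr0n ?Aset_gt0 //.
by rewrite ler_peMr ?exploration_ge0 // ler1n Aset_gt0.
Qed.

Lemma Qhat_deviation k x a w : Qhat k x a w -
  (\sum_(i < k) (visited x a i w)%:R * action_value i x a w) /
    (\sum_(i < k) visited x a i w)%:R =
  (\sum_(i < k) deviation x a i w) / (nvisits (visited x a) k w)%:R.
Proof. by rewrite QhatE -mulrBl -sumrB. Qed.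

Lemma ae_value_cvg : gamma < 1 / 2 -> {ae Pr, forall w, forall x,
  value Aset Pt S gamma (sm_policy (pik w k)) x @[k --> \oo] --> Vstar Aset Pt S gamma x}.
Proof.
move=> g12.
have good (xa : X * Act) : {ae Pr, forall w, xa.2 \in Aset xa.1 ->
    (forall M, \forall k \near \oo, (M <= nvisits (visited xa.1 xa.2) k w)%N) /\
    (\sum_(i < k) deviation xa.1 xa.2 i w) / (nvisits (visited xa.1 xa.2) k w)%:R
      @[k --> \oo] --> 0}.
  case: xa => x a /=; have [aA|/negP naA] := boolP (a \in Aset x); last exact: aeW.
  apply: filterS2 (ae_visited_infinitely_often aA) (ae_deviation_average aA) => w inf avg _.
  by split=> //; exact: avg.
(* There are finitely many pairs, so one null set serves all of them and the rest is pathwise. *)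
apply: filterS (filter_fin_forall _ good) => w {}good x.
apply: (greedy_convergence Aset_gt0 PtP gamma_ge0 gamma_lt1
  (e := fun k x => exploration k x w) (Q := fun k x a => Qhat k x a w)
  (b := fun k x a => visited x a k w)) => //.
- by move=> k; exact: pik_stochastic.
- by move=> k y; exact: exploration_ge0.
- move=> y; apply: exploration_cvg0 => M; have /card_gt0P[a aA] := Aset_gt0 y.
  have [inf _] := good (y, a) aA; apply: filterS (inf M) => k /= /leq_trans; apply.
  by rewrite nstateE (bigD1 a) //= leq_addr.
- by move=> k y a c; exact: pik_greedy.
- by move=> y a aA; have [] := good (y, a) aA.
- move=> y a aA; have [_] := good (y, a) aA.
  by under eq_fun do rewrite -Qhat_deviation.
Qed.
End AlgorithmLaw.

Theorem theorem2p5 (R : realType) (X Act : finType) (Aset : X -> {set Act})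
  (Pt : X -> Act -> X -> R) (S : X -> Act -> X -> probability R R)
  (gamma theta : R) (mu0 : X -> R)
  (d : measure_display) (Omega : measurableType d) (Pr : probability Omega R)
  (Xs : nat -> nat -> Omega -> X) (As : nat -> nat -> Omega -> Act)
  (Rs : nat -> nat -> Omega -> R) :
  (0 < #|X|)%N ->
  (forall x, (0 < #|Aset x|)%N) ->
  (forall x a, a \in Aset x -> (forall y, 0 <= Pt x a y) /\ \sum_(y : X) Pt x a y = 1) ->
  (forall x a y, a \in Aset x -> (\int[S x a y]_r ((r ^+ 2)%:E) < +oo)%E) ->
  0 <= gamma -> gamma < 1 / 2 ->
  0 < theta -> theta <= 1 ->
  (forall x, 0 < mu0 x) -> \sum_(x : X) mu0 x = 1 ->
  algorithm_law Aset Pt S Xs As Rs gamma theta mu0 Pr ->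
  exists N : set Omega, Pr.-negligible N /\
    forall w, ~ N w -> forall x : X,
      (fun k => value Aset Pt S gamma
                  (sm_policy (pibar_at Aset Xs As Rs gamma theta w k)) x)
        @ \oo --> Vstar Aset Pt S gamma x.
Proof.
move=> _ A0 PtP Sm g0 g12 t0 t1 mu0p _ [mX [mA [mR law]]].
have g1 : gamma < 1 by lra.
have H := ae_value_cvg mX mA mR A0 PtP Sm g0 g1 t0 law t1 mu0p g12.
by exists (~` [set w | forall x, value Aset Pt S gamma
    (sm_policy (pibar_at Aset Xs As Rs gamma theta w k)) x @[k --> \oo] -->
    Vstar Aset Pt S gamma x]); split=> // w /contrapT.
Qed.
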